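(* Consider the regression model $y_i=g(x_i)+\sqrt{V(x_i)}\,\epsilon_i$, $i=1,\dots,n$, as specified in the context. Fix $C_1>0$, $C_2>0$, $\beta>0$, $\gamma>0$ (and $\delta>0$) to define the functional classes $\mathcal{C}_\gamma^+$ and $\mathcal{C}_\beta$. Assume that the $\epsilon_i$ are independent with $\epsilon_i\sim N(0,1)$. Then there is a constant $K>0$ such that $$\inf_{\tilde V}\ \sup\{R(V,\tilde V): V\in\mathcal{C}_\gamma^+,\ g\in\mathcal{C}_\beta\}\ \ge\ K\,n^{-2\gamma/(2\gamma+1)},$$ where the infimum is taken over all possible estimators $\tilde V$ of the variance function $V$.
   Context: Model: for each $n$ one observes $y_i=g(x_i)+\sqrt{V(x_i)}\,\epsilon_i$, $i=1,\dots,n$, where $g$ is an unknown mean function and $V\ge0$ an unknown variance function on $[0,1]$. The design points $x_1\le\dots\le x_n$ in $[0,1]$ are fixed (nonrandom, may depend on $n$), and with the convention $x_0=0$, $x_{n+1}=1$ one has $\max_{0\le i\le n}(x_{i+1}-x_i)=O(n^{-1})$. Functional classes: for $\gamma>0$, $\lfloor\gamma\rfloor$ denotes the greatest integer less than $\gamma$, and $\gamma'=\gamma-\lfloor\gamma\rfloor$. A function $f$ belongs to $\mathcal{C}_\gamma$ (depending on $C_1,C_2$) if for all $x,y\in(0,1)$, $|f^{(\lfloor\gamma\rfloor)}(x)-f^{(\lfloor\gamma\rfloor)}(y)|\le C_1|x-y|^{\gamma'}$ and $|f^{(k)}(x)|\le C_2$ for $k=0,\dots,\lfloor\gamma\rfloor-1$.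 $\mathcal{C}_\beta$ is defined in the same way with $\beta$ in place of $\gamma$. For $\delta>0$, $f$ belongs to $\mathcal{C}_\gamma^+$ if $f\in\mathcal{C}_\gamma$ and in addition $f(x)\ge\delta$ for all $x$. An estimator $\tilde V$ is any (measurable) function of the observations $y_1,\dots,y_n$ (and the known design). The constant $K$ does not depend on $n$. Global risk: $R(V,\tilde V)=E\big(\int_0^1(\tilde V(x)-V(x))^2\,dx\big)$.
   Formalization: When γ>1 the formal theorem assumes δ<C_2; otherwise the class C_γ^+ is empty (δ>C_2) or contains only functions equal to C_2 on (0,1) (δ=C_2), and the stated lower bound is false. *)

(* Defs.v *)
From HB Require Import structures.
From mathcomp Require Import all_boot all_order all_algebra.
From mathcomp Require Import all_classical all_reals all_analysis.
Import Order.TTheory GRing.Theory Num.Theory.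
Import numFieldNormedType.Exports.

Set Implicit Arguments.
Unset Strict Implicit.
Unset Printing Implicit Defensive.

Local Open Scope classical_set_scope.
Local Open Scope ring_scope.

(* The greatest integer strictly less than c, for c > 0; in particular it is
   c - 1, not c, when c is an integer. *)
Definition strict_floor (R : realType) (c : R) : nat := `|Num.ceil c - 1|%N.

Lemma strict_floorP (R : realType) (c : R) (k : nat) :
  0 < c -> (k%:R < c) = (k <= strict_floor c)%N.
Proof.
move=> c0; have ceil_gt0 : 0 < Num.ceil c by rewrite Num.Theory.ceil_gt0.
rewrite -[k%:R]/((k%:Z)%:~R) -Num.Theory.ceil_gt_int /strict_floor -lez_nat.
by rewrite gez0_abs ?subr_ge0 ?gtz0_ge1// lerBrDr lezD1.
Qed.

(* Functions on [0, 1] are represented by total functions R -> R of which only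
   the values on [0, 1] are ever used: the derivatives are taken at points of
   the open interval. The clause on derivability makes explicit that the
   derivatives up to order [strict_floor c] exist (the library's derivative is
   total). *)
Definition holder_class (R : realType) (C1 C2 c : R) : set (R -> R) :=
  [set f | let m := strict_floor c in
    [/\ forall (k : nat) (x : R), (k < m)%N -> x \in `]0, 1[ ->
          derivable (f^`(k)%classic) x 1,
        forall x y : R, x \in `]0, 1[ -> y \in `]0, 1[ ->
          `|f^`(m)%classic x - f^`(m)%classic y| <= C1 * `|x - y| `^ (c - m%:R)
      & forall (k : nat) (x : R), (k < m)%N -> x \in `]0, 1[ ->
          `|f^`(k)%classic x| <= C2]].

Definition holder_class_pos (R : realType) (C1 C2 c delta : R) :
    set (R -> R) :=
  [set f | holder_class C1 C2 c f /\
           forall x : R, x \in `[0, 1] -> delta <= f x].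

(* [x n i], for 1 <= i <= n, is the i-th design point of the n-point design;
   [x n 0] and [x n n.+1] are the conventional end points. *)
Definition regular_design (R : realType) (x : nat -> nat -> R) : Prop :=
  [/\ forall n : nat, x n 0%N = 0 /\ x n n.+1 = 1,
      forall n i : nat, (i <= n)%N -> x n i <= x n i.+1
    & (fun n : nat => \big[Num.max/0]_(i < n.+1) (x n i.+1 - x n i))
        =O_\oo (fun n : nat => n%:R^-1 : R)].

Definition mutually_independent d (T : measurableType d) (R : realType)
    (P : probability T R) (I : finType) (X : I -> {RV P >-> R}) : Prop :=
  forall (J : {set I}) (A : I -> set R), (forall i, measurable (A i)) ->
    P (\bigcap_(i in [set` J]) (X i @^-1` A i)) =
    (\prod_(i in J) P (X i @^-1` A i))%E.

(* [normal_prob m s] has mean m and standard deviation s. *)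
Definition standard_normal d (T : measurableType d) (R : realType)
    (P : probability T R) (X : {RV P >-> R}) : Prop :=
  forall A : set R, measurable A -> distribution P X A = normal_prob 0 1 A.

Section regression_model.
Context d (T : measurableType d) (R : realType) (P : probability T R).
Variables (x : nat -> nat -> R) (eps : forall n : nat, 'I_n -> {RV P >-> R}).

(* As i : 'I_n is counted from 0, the i-th observation is at [x n i.+1]. *)
Definition observations (g V : R -> R) (n : nat) (w : T) : n.-tuple R :=
  [tuple g (x n i.+1) + Num.sqrt (V (x n i.+1)) * eps i w | i < n].

(* An estimator maps the data y to a function on [0, 1]; joint measurability in
   the data and the argument is what gives a meaning to the risk E(int ...). *)
Definition estimator (n : nat) : set (n.-tuple R -> R -> R) :=
  [set Vt | measurable_fun ([set: n.-tuple R] `*` (`[(0 : R), 1] : set R))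
              (fun z : n.-tuple R * R => Vt z.1 z.2)].

Definition global_risk (n : nat) (g V : R -> R) (Vt : n.-tuple R -> R -> R) :
    \bar R :=
  (\int[P]_w \int[lebesgue_measure]_(t in `[0%R, 1%R])
     ((Vt (observations g V n w) t - V t) ^+ 2)%:E)%E.

Definition minimax_risk (n : nat) (Vclass gclass : set (R -> R)) : \bar R :=
  ereal_inf [set ereal_sup [set global_risk gV.1 gV.2 Vt
                               | gV in gclass `*` Vclass]
              | Vt in @estimator n].

End regression_model.

(* Main.v *)
Require Import Defs.
From HB Require Import structures.
From mathcomp Require Import all_boot all_order all_algebra.
From mathcomp Require Import all_classical all_reals all_analysis.
From mathcomp Require Import measurable_realfun ring lra.
Import Order.TTheory GRing.Theory Num.Theory.
Import numFieldNormedType.Exports.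
Set Implicit Arguments.
Unset Strict Implicit.
Unset Printing Implicit Defensive.
Local Open Scope classical_set_scope.
Local Open Scope ring_scope.

(** The bound already holds with a vanishing mean, so the data are taken to
    be y_i = sqrt(V(x_i)) eps_i; the proof is Assouad's argument. Cut [0, 1]
    into M cells of width h = 1/M, and on each cell add to the constant
    variance delta a nonnegative bump A phi((t - j h) / h), switched on or
    off by a bit theta_j, with A = c h^gamma. By scaling, for small c all
    these 2^M functions lie in the Hoelder class, whatever M is
    ([bump_variance_holder]).

    On a given cell the losses against the two values of theta_j add up to
    at least half the squared L2 norm of the bump, of order A^2 h
    ([cell_separation]). Hence, as soon as the laws of the data under two
    vectors differing only in theta_j overlap enough, no estimator has a
    small expected loss on that cell under both ([cell_two_point]).
    Averaging over all theta and adding the M cells ([assouad]) bounds the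
    risk below by a multiple of A^2, that is, of h^(2 gamma).

    The two laws are products of centred normals whose variances differ only
    at the design points inside the cell, by factors r_i between 1 and 1 +
    O(A). Take the law with the larger variances as reference, and let L be
    the density of the other one. Then E L = 1, E L^2 <= exp(sum_i (r_i -
    1)^2 / 2), and min(1, L) >= L - L^2 / 4, so that the overlap E min(1, L)
    is at least 1/2 whenever sum_i (r_i - 1)^2 <= 1 ([gaussian_two_point]).
    This sum is at most a constant times A^2 times the number of design
    points in the cell. Design points may cluster in a few cells, but there
    are n of them in all: the overlap is only needed on the cells holding at
    most 2n/M points ([minimax_risk_ge_bumps]). The condition becomes n h^(2
    gamma + 1) <= 1 up to constants, and M of order n^(1 / (2 gamma + 1))
    gives the announced rate. *)

(** * Equality of weighted laws: from events to functions *)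

Section weighted_transfer.
Context d1 d2 d' (T1 : measurableType d1) (T2 : measurableType d2)
  (T' : measurableType d') (R : realType).
Local Open Scope ereal_scope.

Import HBNNSimple.

(** The right-hand side depends on mu, L and Y only through the weighted masses
    of the events Y \in A, which is what makes [eq_weighted_integral] work. *)
Lemma ge0_weighted_integral_lim d (T : measurableType d)
    (mu : {measure set T -> \bar R}) (L : T -> R) (Y : T -> T')
    (F : T' -> \bar R) (mF : measurable_fun setT F) :
  measurable_fun setT L -> (forall w, 0 <= L w)%R -> measurable_fun setT Y ->
  (forall y, 0 <= F y) ->
  \int[mu]_w ((L w)%:E * F (Y w)) =
  limn (fun n => \sum_(r \in range (nnsfun_approx measurableT mF n))
    r%:E * \int[mu]_w ((L w)%:E *
      (\1_(nnsfun_approx measurableT mF n @^-1` [set r]) (Y w))%:E)).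
Proof.
move=> mL L0 mY F0; set f_ := nnsfun_approx measurableT mF.
transitivity (limn (fun n => \int[mu]_w ((L w)%:E * (f_ n (Y w))%:E))).
  rewrite -monotone_convergence//=.
  - apply: eq_integral => w _; apply/esym/cvg_lim => //.
    apply: cvgeZl => //.
    exact: (@cvg_nnsfun_approx _ _ _ _ measurableT _ mF (fun y _ => F0 y)).
  - move=> n; apply: emeasurable_funM; first exact/measurable_EFinP.
    by apply/measurable_EFinP/measurableT_comp.
  - by move=> n w _; rewrite mule_ge0// lee_fin.
  - move=> w _ a b ab; rewrite lee_wpmul2l ?lee_fin//.
    exact/lefP/nd_nnsfun_approx.
congr (limn _); apply/funext => n.
have mI r : measurable_fun [set: T]
    (fun w => (L w)%:E * (\1_(f_ n @^-1` [set r]) (Y w))%:E).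
  apply: emeasurable_funM; first exact/measurable_EFinP.
  by apply/measurable_EFinP/measurableT_comp.
transitivity (\int[mu]_w (\sum_(r \in range (f_ n))
    r%:E * ((L w)%:E * (\1_(f_ n @^-1` [set r]) (Y w))%:E))).
  apply: eq_integral => w _; rewrite [X in _ * X%:E]fimfunE -fsumEFin//.
  rewrite ge0_mule_fsumr//; last first.
    by move=> r; rewrite EFinM nnfun_muleindic_ge0.
  by apply: eq_fsbigr => r _; rewrite EFinM muleCA.
rewrite ge0_integral_fsum//; last 2 first.
- by move=> r; exact: measurable_funeM.
- move=> r w _; rewrite muleCA mule_ge0 ?lee_fin//.
  exact: nnfun_muleindic_ge0.
apply: eq_fsbigr => r; rewrite inE => -[y _ <-].
by rewrite ge0_integralZl// ?lee_fin// => w _; rewrite mule_ge0// lee_fin.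
Qed.

(** Serves both to factor expectations of independent variables (one weight is
    then a constant) and to change measure (one weight is then a density). *)
Lemma eq_weighted_integral (mu1 : {measure set T1 -> \bar R})
    (mu2 : {measure set T2 -> \bar R}) (L1 : T1 -> R) (L2 : T2 -> R)
    (Y1 : T1 -> T') (Y2 : T2 -> T') :
  measurable_fun setT L1 -> (forall w, 0 <= L1 w)%R -> measurable_fun setT Y1 ->
  measurable_fun setT L2 -> (forall w, 0 <= L2 w)%R -> measurable_fun setT Y2 ->
  (forall A, measurable A ->
    \int[mu1]_w ((L1 w)%:E * (\1_A (Y1 w))%:E) =
    \int[mu2]_w ((L2 w)%:E * (\1_A (Y2 w))%:E)) ->
  forall F : T' -> \bar R, measurable_fun setT F -> (forall y, 0 <= F y) ->
    \int[mu1]_w ((L1 w)%:E * F (Y1 w)) = \int[mu2]_w ((L2 w)%:E * F (Y2 w)).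
Proof.
move=> mL1 L10 mY1 mL2 L20 mY2 H F mF F0.
rewrite !(@ge0_weighted_integral_lim _ _ _ _ _ F mF)//; congr (limn _).
apply/funext => n; apply: eq_fsbigr => r _; congr (_ * _).
by apply: H; exact: measurable_sfunP.
Qed.

End weighted_transfer.

(** * Expectation of a product of functions of independent variables *)

Section independence.
Context d (T : measurableType d) (R : realType) (P : probability T R).
Variables (I : finType) (X : I -> {RV P >-> R}).
Hypothesis X_indep : mutually_independent X.
Local Open Scope ereal_scope.

(** Independence is the case where all functions are indicators; the functions
    indexed by s are released from being indicators one at a time.  When all
    but f k are fixed, both sides are measures in A for f k = \1_A. *)
Let integral_prod_indep_seq (s : seq I) (f : I -> R -> R) :
  (forall i, measurable_fun setT (f i)) -> (forall i x, 0 <= f i x)%R ->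
  (forall i, \int[P]_w (f i (X i w))%:E < +oo) ->
  (forall i, i \notin s -> exists2 A, measurable A & f i = \1_A) ->
  \int[P]_w (\prod_i f i (X i w))%:E = \prod_i \int[P]_w (f i (X i w))%:E.
Proof.
elim: s f => [|k s IH] f mf f0 foo fs.
  have /choice[A fA] : forall i, exists A, measurable A /\ f i = \1_A.
    by move=> i; have [//|A] := fs i; exists A.
  have mA i : measurable (A i) by case: (fA i).
  have mXA i : measurable (X i @^-1` A i).
    by rewrite -[X in measurable X]setTI; exact: measurable_funP.
  rewrite (eq_integral (fun w =>
      (\1_(\bigcap_(i in [set` [set: I]%SET]) (X i @^-1` A i)) w)%:E)).
    rewrite integral_indic//; last first.
      by apply: fin_bigcap_measurable => //; exact: finite_finset.
    rewrite setIT; etransitivity.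
      exact: (@X_indep (finset.setTfor I) A mA).
    under [LHS]eq_bigl do rewrite finset.in_setT.
    apply: eq_bigr => i _; rewrite (fA i).2.
    by rewrite (integral_indic _ _ (mXA i))// setIT.
  move=> w _; congr (_%:E); rewrite indicE.
  under eq_bigr do rewrite (fA _).2 indicE.
  have [h|h] := boolP (w \in _).
    apply: big1 => i _; rewrite mem_set//; move: h; rewrite inE; apply.
    by rewrite /= finset.in_setT.
  have [i hi] : exists i, X i w \notin A i.
    apply/existsP; rewrite -negb_forall; apply: contra h => /forallP h.
    by rewrite inE => i _; have := h i; rewrite inE.
  by rewrite (bigD1 i)//= (negbTE hi) mul0r.
pose W w := (\prod_(i | i != k) f i (X i w))%R.
pose c := fine (\prod_(i | i != k) \int[P]_w (f i (X i w))%:E).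
have fge0 i : 0 <= \int[P]_w (f i (X i w))%:E.
  by apply: integral_ge0 => w _; rewrite lee_fin.
have c0 : 0 <= \prod_(i | i != k) \int[P]_w (f i (X i w))%:E.
  by apply: prode_ge0 => i _; exact: fge0.
have cE : \prod_(i | i != k) \int[P]_w (f i (X i w))%:E = c%:E.
  rewrite fineK//; apply: (big_ind (fun z => z \is a fin_num)) => //.
    by move=> x y; exact: fin_numM.
  by move=> i _; rewrite ge0_fin_numE.
have c_ge0 : (0 <= c)%R by rewrite -lee_fin -cE.
have mfX i : measurable_fun setT (fun w => f i (X i w)).
  by apply: measurableT_comp => //; exact: mf.
rewrite (bigD1 k)//= cE muleC.
under eq_integral do rewrite (bigD1 k)//= mulrC EFinM.
rewrite -ge0_integralZl//; last 2 first.
- exact/measurable_EFinP.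
- by move=> w _; rewrite lee_fin.
apply: (@eq_weighted_integral _ _ _ T T _ R P P W (fun=> c) (X k) (X k)
  _ _ _ _ _ _ _ (fun x => (f k x)%:E)) => //.
- rewrite (_ : W = fun w =>
      \prod_i if i != k then f i (X i w) else 1)%R; last first.
    by apply/funext => w; rewrite /W big_mkcond.
  apply: measurable_prod => i _ /=.
  case: (i != k); first exact: (mfX i).
  exact: measurable_cst.
- by move=> w; apply: prodr_ge0 => i _.
- move=> A mA.
  pose f' i := if i == k then \1_A else f i.
  have f'k : f' k = \1_A by rewrite /f' eqxx.
  have f'i i : i != k -> f' i = f i by move=> /negbTE ik; rewrite /f' ik.
  have mf' i : measurable_fun setT (f' i).
    by rewrite /f'; case: eqP => // _; exact: measurable_indic.
  have f'0 i x : (0 <= f' i x)%R by rewrite /f'; case: eqP.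
  have f'W w : (\prod_i f' i (X i w) = W w * \1_A (X k w))%R.
    rewrite (bigD1 k)//= f'k mulrC; congr (_ * _)%R.
    by apply: eq_bigr => i ik; rewrite f'i.
  have f'c : \prod_i \int[P]_w (f' i (X i w))%:E =
      c%:E * \int[P]_w (\1_A (X k w))%:E.
    rewrite (bigD1 k)//= f'k muleC -cE; congr (_ * _).
    by apply: eq_bigr => i ik; rewrite f'i.
  under eq_integral do rewrite -EFinM -f'W.
  rewrite (IH f' mf' f'0) ?f'c.
  + rewrite -ge0_integralZl//.
    by apply/measurable_EFinP/measurableT_comp.
  + move=> i; have [->|ik] := eqVneq i k; last by rewrite f'i.
    rewrite f'k (integral_indic _ _ (_ : measurable (X k @^-1` A)))//.
      by rewrite setIT (le_lt_trans (probability_le1 _ _))// ?ltry//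
        -[X in measurable X]setTI; exact: measurable_funP.
    by rewrite -[X in measurable X]setTI; exact: measurable_funP.
  + move=> i iS; have [->|ik] := eqVneq i k; first by exists A.
    by rewrite f'i//; apply: fs; rewrite inE negb_or ik.
- by apply/measurable_EFinP; exact: mf.
- by move=> x; rewrite lee_fin.
Qed.

Lemma integral_prod_indep (f : I -> R -> R) :
  (forall i, measurable_fun setT (f i)) -> (forall i x, 0 <= f i x)%R ->
  (forall i, \int[P]_w (f i (X i w))%:E < +oo) ->
  \int[P]_w (\prod_i f i (X i w))%:E = \prod_i \int[P]_w (f i (X i w))%:E.
Proof.
move=> mf f0 foo; apply: (integral_prod_indep_seq (s := enum I)) => // i.
by rewrite mem_enum.
Qed.

End independence.

(** * Rescaling a standard normal variable *)

Section gaussian_scaling.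
Context (R : realType).
Local Notation mu := (@lebesgue_measure R).
Local Open Scope ereal_scope.

Lemma ge0_integral_lebesgue_scale (s : R) (F : R -> \bar R) : (0 < s)%R ->
  measurable_fun setT F -> (forall x, 0 <= F x) ->
  \int[mu]_x F (x / s)%R = s%:E * \int[mu]_x F x.
Proof.
move=> s0 mF F0.
pose phi (x : measurableTypeR R) : measurableTypeR R := (x / s)%R.
have mphi : measurable_fun setT phi by exact: measurable_funM.
have s1_ge0 : (0 <= s^-1)%R by rewrite invr_ge0 ltW.
pose pf : {measure set (measurableTypeR R) -> \bar R} :=
  measure_function_pushforward__canonical__measure_function_Measure mu mphi.
have E A : measurable A -> mu A = mscale (NngNum s1_ge0) pf A.
  move=> mA; apply: lebesgue_measure_unique => // _ [[a b]] _ <-.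
  rewrite /mscale/= /pushforward/=.
  rewrite [X in _ = _ * lebesgue_measure X](_ : _ =
      `](a * s)%R, (b * s)%R]%classic); last first.
    by apply/seteqP; split => x /=;
      rewrite !in_itv/= ltr_pdivlMr// ler_pdivrMr.
  rewrite !lebesgue_measure_itv/= !lte_fin ltr_pM2r//.
  case: ifP => _; last by rewrite mule0.
  by rewrite -!EFinB -EFinM -mulrBl mulrCA mulVf ?mulr1// gt_eqF.
rewrite [in RHS](eq_measure_integral (mscale (NngNum s1_ge0) pf)); last first.
  by move=> A mA _; exact: E.
rewrite ge0_integral_mscale// muleA -EFinM mulfV ?gt_eqF// mul1e.
by rewrite ge0_integral_pushforward.
Qed.

Lemma standard_normal_integral d (T : measurableType d) (P : probability T R)
    (X : {RV P >-> R}) (F : R -> \bar R) : standard_normal X ->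
  measurable_fun setT F -> (forall x, 0 <= F x) ->
  \int[P]_w F (X w) = \int[mu]_z ((normal_pdf 0 1 z)%:E * F z).
Proof.
move=> X_normal mF F0.
transitivity (\int[P]_w ((cst 1%R w)%:E * F (X w))).
  by apply: eq_integral => w _; rewrite mul1e.
apply: (@eq_weighted_integral _ _ _ T (measurableTypeR R) R R P mu (cst 1%R)
  (normal_pdf 0 1) X id) => //.
- exact: measurable_normal_pdf.
- by move=> z; exact: normal_pdf_ge0.
- move=> A mA.
  have mXA : measurable (X @^-1` A).
    by rewrite -[X in measurable X]setTI; exact: measurable_funP.
  under eq_integral do rewrite mul1e.
  rewrite (integral_indic _ _ mXA)// setIT.
  transitivity (normal_prob 0 1 A); first exact: (X_normal A mA).
  rewrite /normal_prob [LHS]integral_mkcond epatch_indic.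
  by apply: eq_integral.
Qed.

(** The density of N(0, 1/r) with respect to N(0, 1). *)
Definition scale_lr (r z : R) : R := Num.sqrt r * expR (- z ^+ 2 * (r - 1) / 2).

Lemma scale_lr_ge0 r z : (0 <= scale_lr r z)%R.
Proof. by rewrite mulr_ge0 ?sqrtr_ge0 ?expR_ge0. Qed.

Lemma measurable_scale_lr r : measurable_fun setT (scale_lr r).
Proof.
apply: measurable_funM => //; apply: measurableT_comp => //.
apply: measurable_funM => //; apply: measurable_funM => //.
by apply: measurableT_comp => //; exact: measurable_funX.
Qed.

Lemma normal_pdf_scale r z : (0 <= r)%R ->
  (Num.sqrt r * normal_pdf 0 1 (Num.sqrt r * z) =
   scale_lr r z * normal_pdf 0 1 z)%R.
Proof.
move=> r0; rewrite !normal_pdfE ?oner_eq0//= /scale_lr -!mulrA; congr (_ * _)%R.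
rewrite [RHS]mulrCA; congr (_ * _)%R; rewrite /normal_fun -expRD.
congr expR; rewrite !subr0 exprMn sqr_sqrtr// expr1n; by field.
Qed.

Lemma standard_normal_scale d (T : measurableType d) (P : probability T R)
    (X : {RV P >-> R}) (r : R) (F : R -> \bar R) : standard_normal X ->
  (0 < r)%R -> measurable_fun setT F -> (forall x, 0 <= F x) ->
  \int[P]_w F (X w / Num.sqrt r)%R =
  \int[P]_w ((scale_lr r (X w))%:E * F (X w)).
Proof.
move=> X_normal r0 mF F0; have s0 : (0 < Num.sqrt r)%R by rewrite sqrtr_gt0.
rewrite (@standard_normal_integral _ _ _ X (fun z => F (z / Num.sqrt r)%R))//.
rewrite (@standard_normal_integral _ _ _ X
  (fun z => (scale_lr r z)%:E * F z))//; last 2 first.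
- apply: emeasurable_funM => //; apply/measurable_EFinP.
  exact: measurable_scale_lr.
- by move=> z; rewrite mule_ge0// lee_fin scale_lr_ge0.
- pose G (z : R) := (normal_pdf 0 1 (Num.sqrt r * z))%:E * F z.
  transitivity (\int[mu]_z G (z / Num.sqrt r)%R).
    by apply: eq_integral; move=> z _; rewrite /G mulrCA mulfV ?mulr1 ?gt_eqF.
  have mG : measurable_fun setT G.
    apply: emeasurable_funM => //; apply/measurable_EFinP.
    apply: measurableT_comp; first exact: measurable_normal_pdf.
    exact: measurable_funM.
  have G0 z : 0 <= G z by rewrite mule_ge0// lee_fin normal_pdf_ge0.
  rewrite ge0_integral_lebesgue_scale//.
  rewrite -ge0_integralZl//.
  apply: eq_integral => z _; rewrite /G !muleA -!EFinM normal_pdf_scale ?ltW//.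
  by rewrite [in RHS]mulrC.
- by apply: measurableT_comp => //; exact: measurable_funM.
Qed.

Lemma integral_scale_lr d (T : measurableType d) (P : probability T R)
    (X : {RV P >-> R}) (r : R) : standard_normal X -> (0 < r)%R ->
  \int[P]_w (scale_lr r (X w))%:E = 1.
Proof.
move=> X_normal r0.
transitivity (\int[P]_w cst 1 (X w / Num.sqrt r)%R).
  by rewrite standard_normal_scale//; apply: eq_integral => w _; rewrite mule1.
by rewrite integral_cst// mul1e; exact: probability_setT.
Qed.

(** The exact value is r / sqrt(2r - 1) = sqrt(1 + (r - 1)^2 / (2r - 1)); the
    dependence on r - 1 is quadratic, and this is what makes the squared bump
    height times the number of design points the measure of detectability. *)
Lemma integral_sqr_scale_lr d (T : measurableType d) (P : probability T R)
    (X : {RV P >-> R}) (r : R) : standard_normal X -> (1 <= r)%R ->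
  \int[P]_w ((scale_lr r (X w)) ^+ 2)%:E <= (expR ((r - 1) ^+ 2 / 2))%:E.
Proof.
move=> X_normal r1; have r0 : (0 < r)%R by apply: lt_le_trans r1.
have r2 : (0 < 2 * r - 1)%R by lra.
have s2 : (0 < Num.sqrt (2 * r - 1))%R by rewrite sqrtr_gt0.
(* The square is again a Gaussian density ratio, up to a constant. *)
have E z : (scale_lr r z ^+ 2 =
    r / Num.sqrt (2 * r - 1) * scale_lr (2 * r - 1) z)%R.
  rewrite /scale_lr exprMn sqr_sqrtr ?ltW// -[RHS]mulrA; congr (_ * _)%R.
  rewrite [RHS]mulrA mulVf ?gt_eqF// mul1r -expRM_natl; congr expR.
  by rewrite -mulr_natl; field.
under eq_integral do rewrite E EFinM.
rewrite ge0_integralZl//; last 3 first.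
- by apply/measurable_EFinP/measurableT_comp => //; exact: measurable_scale_lr.
- by move=> w _; rewrite lee_fin scale_lr_ge0.
- by rewrite lee_fin divr_ge0// ltW.
rewrite integral_scale_lr// mule1 lee_fin ler_pdivrMr//.
rewrite -(@ler_pXn2r _ 2)// ?nnegrE; last 2 first.
- exact: ltW.
- by rewrite mulr_ge0 ?expR_ge0 ?sqrtr_ge0.
rewrite exprMn (sqr_sqrtr (ltW r2)) -expRM_natl.
apply: (@le_trans _ _ ((1 + (r - 1) ^+ 2) * (2 * r - 1)))%R.
  rewrite -subr_ge0; have -> : ((1 + (r - 1) ^+ 2) * (2 * r - 1) - r ^+ 2 =
    2 * (r - 1) ^+ 3)%R by ring.
  by rewrite mulr_ge0// exprn_ge0// subr_ge0.
rewrite ler_pM2r//; apply: le_trans (expR_ge1Dx _) _.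
by rewrite ler_expR -mulr_natl mulrCA mulfV ?mulr1.
Qed.

End gaussian_scaling.

(** * Change of measure for a vector of independent normals *)

Section tuple_boxes.
Context (R : realType) (n : nat).

Definition tuple_box (A : 'I_n -> set R) : set (n.-tuple R) :=
  [set y | forall i, A i (tnth y i)].

Lemma measurable_tuple_box (A : 'I_n -> set R) :
  (forall i, measurable (A i)) -> measurable (tuple_box A).
Proof.
move=> mA; rewrite (_ : tuple_box A =
    \bigcap_(i in [set: 'I_n]) ((fun y => tnth y i) @^-1` A i)).
  apply: fin_bigcap_measurable => // i _; rewrite -[X in measurable X]setTI.
  exact: measurable_tnth.
by apply/seteqP; split=> y /= yA i; [move=> _; exact: yA|exact: yA].
Qed.

Lemma measurable_tupleE : @measurable _ (n.-tuple R) =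
  <<s [set tuple_box A | A in [set A | forall i, measurable (A i)]] >>.
Proof.
apply/seteqP; split; last first.
  apply: smallest_sub; first exact: sigma_algebra_measurable.
  by move=> _ [A mA <-]; exact: measurable_tuple_box.
apply: smallest_sub; first exact: smallest_sigma_algebra.
rewrite -bigcup_seq => _ [i _ [B mB <-]]; rewrite setTI.
apply: sub_sigma_algebra; exists (fun j => if j == i then B else setT).
  by move=> j; case: ifP.
apply/seteqP; split=> y /= yB; first by have := yB i; rewrite eqxx.
by move=> j; case: eqP => // ->.
Qed.

Lemma tuple_measure_unique (m1 m2 : {measure set (n.-tuple R) -> \bar R}) :
  (m1 setT < +oo)%E ->
  (forall A, (forall i, measurable (A i)) ->
    m1 (tuple_box A) = m2 (tuple_box A)) ->
  forall B, measurable B -> m1 B = m2 B.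
Proof.
move=> m1oo m12 B mB.
apply: (measure_unique
  [set tuple_box A | A in [set A | forall i, measurable (A i)]]
  (fun=> setT)) => //.
- exact: measurable_tupleE.
- move=> _ _ [A mA <-] [A' mA' <-]; exists (fun i => A i `&` A' i).
    by move=> i; exact: measurableI.
  by apply/seteqP; split=> y /=; [move=> h; split=> i; have [] := h i|
    move=> [h h'] i; split].
- by move=> _; exists (fun=> setT) => //; apply/seteqP; split.
- by rewrite bigcup_const.
- by move=> _ [A mA <-]; exact: m12.
Qed.

End tuple_boxes.

Section gaussian_tuples.
Context d (T : measurableType d) (R : realType) (P : probability T R) (n : nat).
Variable X : 'I_n -> {RV P >-> R}.
Hypothesis X_indep : mutually_independent X.
Hypothesis X_normal : forall i, standard_normal (X i).
Local Open Scope ereal_scope.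

Let noise w : n.-tuple R := [tuple X i w | i < n].
Let shrunk (r : 'I_n -> R) w : n.-tuple R :=
  [tuple (X i w / Num.sqrt (r i))%R | i < n].
Let LR (r : 'I_n -> R) w : R := (\prod_i scale_lr (r i) (X i w))%R.

Let measurable_noise : measurable_fun setT noise.
Proof.
apply/measurable_fun_tnthP => i.
rewrite (_ : _ \o _ = X i)//; by apply/funext => w /=; rewrite tnth_mktuple.
Qed.

Let measurable_shrunk r : measurable_fun setT (shrunk r).
Proof.
apply/measurable_fun_tnthP => i.
rewrite (_ : _ \o _ = fun w => (X i w / Num.sqrt (r i))%R).
  exact: measurable_funM.
by apply/funext => w /=; rewrite tnth_mktuple.
Qed.

Let measurable_LR r : measurable_fun setT (LR r).
Proof.
apply: measurable_prod => i _; apply: measurableT_comp => //.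
exact: measurable_scale_lr.
Qed.

Let LR_ge0 r w : (0 <= LR r w)%R.
Proof. by apply: prodr_ge0 => i _; exact: scale_lr_ge0. Qed.

Let integral_LR r : (forall i, (0 < r i)%R) -> \int[P]_w (LR r w)%:E = 1.
Proof.
move=> r0; rewrite (integral_prod_indep X_indep (f := fun i => scale_lr (r i))).
- by apply: big1 => i _; exact: integral_scale_lr.
- by move=> i; exact: measurable_scale_lr.
- by move=> i x; exact: scale_lr_ge0.
- by move=> i; rewrite integral_scale_lr// ltry.
Qed.

(** By independence the left-hand side is at most exp(1/2).  A bound below 4 is
    what [gaussian_two_point] asks for; 2 leaves half of the constant there. *)
Let integral_sqr_LR r : (forall i, (1 <= r i)%R) ->
  (\sum_i (r i - 1) ^+ 2 <= 1)%R -> \int[P]_w (LR r w ^+ 2)%:E <= 2%:E.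
Proof.
move=> r1 rs.
under eq_integral do rewrite /LR -prodrXl.
rewrite (integral_prod_indep X_indep
  (f := fun i z => (scale_lr (r i) z ^+ 2)%R)).
- apply: (@le_trans _ _ (\prod_i (expR ((r i - 1) ^+ 2 / 2))%:E)).
    apply: (proj2 (_ : 0 <= _ /\ _ <= _)).
    apply: (big_ind2 (fun a b => 0 <= a /\ a <= b))
      => [//|a b a' b' [a0 ab] [a'0 ab']|i _].
      by split; [exact: mule_ge0|exact: lee_pmul].
    split; last exact: integral_sqr_scale_lr.
    by apply: integral_ge0 => w _; rewrite lee_fin sqr_ge0.
  rewrite prodEFin lee_fin -expR_sum -mulr_suml.
  apply: (@le_trans _ _ (expR (1 / 2)))%R.
    by rewrite ler_expR ler_pM2r.
  (* exp(1/2) <= 2, since exp(-1/2) >= 1 - 1/2 *)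
  have := expR_ge1Dx (- (1 / 2) : R); rewrite expRN => h.
  rewrite -[leRHS]invrK -[leLHS]invrK lef_pV2 ?posrE ?invr_gt0 ?expR_gt0//.
  by apply: le_trans h; lra.
- by move=> i; apply: measurable_funX; exact: measurable_scale_lr.
- by move=> i x; exact: sqr_ge0.
- move=> i; apply: le_lt_trans (ltry (expR ((r i - 1) ^+ 2 / 2))).
  exact: integral_sqr_scale_lr.
Qed.

(** Both sides define finite measures on tuples, so it suffices to compare them
    on boxes, where independence reduces the claim to one coordinate at a
    time. *)
Lemma gaussian_tuple_scale (r : 'I_n -> R) (F : n.-tuple R -> \bar R) :
  (forall i, (0 < r i)%R) -> measurable_fun setT F -> (forall y, 0 <= F y) ->
  \int[P]_w F (shrunk r w) = \int[P]_w ((LR r w)%:E * F (noise w)).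
Proof.
move=> r0 mF F0.
transitivity (\int[P]_w ((cst 1%R w)%:E * F (shrunk r w))).
  by apply: eq_integral => w _; rewrite mul1e.
apply: eq_weighted_integral => //.
move=> B mB.
pose nu (A : set (n.-tuple R)) := \int[P]_(w in noise @^-1` A) (LR r w)%:E.
have mN A : measurable A -> measurable (noise @^-1` A).
  by move=> mA; rewrite -[X in measurable X]setTI; exact: measurable_noise.
have mS A : measurable A -> measurable (shrunk r @^-1` A).
  by move=> mA; rewrite -[X in measurable X]setTI; exact: measurable_shrunk.
have nuE A : nu A = \int[P]_w ((LR r w)%:E * (\1_A (noise w))%:E).
  by rewrite /nu integral_mkcond epatch_indic; apply: eq_integral.
have nu0 : nu set0 = 0 by rewrite /nu preimage_set0 integral_set0.
have nu_ge0 A : 0 <= nu A by apply: integral_ge0 => w _; rewrite lee_fin.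
have nu_sigma : semi_sigma_additive nu.
  move=> G mG tG mUG; rewrite /nu preimage_bigcup ge0_integral_bigcup//.
  - apply: is_cvg_ereal_nneg_natsum_cond => k _ _.
    by apply: integral_ge0 => w _; rewrite lee_fin.
  - by move=> k; exact: mN.
  - by apply/measurable_EFinP; exact: measurable_funTS.
  - by move=> w _; rewrite lee_fin.
  - apply/trivIsetP => i j _ _ ij; rewrite -preimage_setI.
    by move/trivIsetP : tG => /(_ _ _ _ _ ij) ->//; rewrite preimage_set0.
pose nuM : {measure set (n.-tuple R) -> \bar R} :=
  HB.pack nu (isMeasure.Build _ _ _ nu nu0 nu_ge0 nu_sigma).
pose pf : {measure set (n.-tuple R) -> \bar R} :=
  measure_function_pushforward__canonical__measure_function_Measure P
    (measurable_shrunk r).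
have E1 A : measurable A -> pf A = \int[P]_w (\1_A (shrunk r w))%:E.
  by move=> mA; rewrite (integral_indic _ _ (mS A mA))// setIT.
suff pfnu : pf B = nuM B.
  transitivity (pf B); last by rewrite pfnu -nuE.
  by rewrite E1//; apply: eq_integral => w _; rewrite mul1e.
apply: tuple_measure_unique => // [|A mA].
  apply: (@le_lt_trans _ _ 1); last exact: ltry.
  by apply: (probability_le1 P); exact: mS.
rewrite E1; last exact: measurable_tuple_box.
rewrite [RHS]nuE.
have boxE (y : n.-tuple R) : \1_(tuple_box A) y =
    (\prod_i \1_(A i) (tnth y i))%R :> R.
  rewrite indicE; have [|/negP h] := boolP (y \in tuple_box A).
    by rewrite inE => yA; rewrite big1// => i _; rewrite indicE mem_set.
  have [i hi] : exists i, tnth y i \notin A i.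
    apply/existsP; rewrite -negb_forall; apply/negP => /forallP yA; apply: h.
    by rewrite inE => i; have := yA i; rewrite inE.
  by rewrite (bigD1 i)//= indicE (negbTE hi) mul0r.
under eq_integral => w _ do
  (rewrite boxE; under eq_bigr do rewrite tnth_mktuple).
under [RHS]eq_integral => w _ do
  (rewrite boxE -EFinM -big_split/=; under eq_bigr do rewrite tnth_mktuple).
have mA1 i : measurable_fun setT (\1_(A i) : R -> R) by exact: measurable_indic.
have mX1 i : measurable_fun setT
    (fun z => scale_lr (r i) z * \1_(A i) z : R)%R.
  by apply: measurable_funM => //; exact: measurable_scale_lr.
have scaleE i : \int[P]_w (\1_(A i) (X i w / Num.sqrt (r i)))%:E =
    \int[P]_w (scale_lr (r i) (X i w) * \1_(A i) (X i w))%:E.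
  rewrite (standard_normal_scale (F := fun z => (\1_(A i) z)%:E))//.
  exact/measurable_EFinP.
have fin1 i : \int[P]_w (scale_lr (r i) (X i w) * \1_(A i) (X i w))%:E < +oo.
  apply: (@le_lt_trans _ _ 1); last exact: ltry.
  rewrite -[leRHS](integral_scale_lr (X_normal i) (r0 i)).
  apply: ge0_le_integral => //.
  - by move=> w _; rewrite lee_fin mulr_ge0// scale_lr_ge0.
  - apply/measurable_EFinP.
    exact: (measurableT_comp (mX1 i) (measurable_funP (X i))).
  - apply/measurable_EFinP.
    exact: (measurableT_comp (measurable_scale_lr (r i))
      (measurable_funP (X i))).
  - by move=> w _; rewrite lee_fin ler_piMr// scale_lr_ge0.
rewrite (integral_prod_indep X_indep
  (f := fun i z => \1_(A i) (z / Num.sqrt (r i))%R))//.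
- rewrite (integral_prod_indep X_indep
    (f := fun i z => (scale_lr (r i) z * \1_(A i) z)%R))//.
  + by apply: eq_bigr => i _; exact: scaleE.
  + by move=> i z; rewrite mulr_ge0// scale_lr_ge0.
- by move=> i; apply: measurableT_comp => //; exact: measurable_funM.
- by move=> i; rewrite scaleE.
Qed.

(** Le Cam's two-point bound.  With L the density of the first law with respect
    to the second, the sum is E (L F0 + F1) >= c E min(1, L), and
    min(1, L) >= L - L^2 / 4 has expectation at least 1 - 2/4.  The square is
    kept on the right-hand side, so that no integral is ever subtracted. *)
Lemma gaussian_two_point (r : 'I_n -> R) (c : R)
    (F0 F1 : n.-tuple R -> \bar R) :
  (forall i, (1 <= r i)%R) -> (\sum_i (r i - 1) ^+ 2 <= 1)%R -> (0 <= c)%R ->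
  measurable_fun setT F0 -> (forall y, 0 <= F0 y) ->
  measurable_fun setT F1 -> (forall y, 0 <= F1 y) ->
  (forall y, c%:E <= F0 y + F1 y) ->
  (c / 2)%:E <= \int[P]_w F0 [tuple (X i w / Num.sqrt (r i))%R | i < n] +
                \int[P]_w F1 [tuple X i w | i < n].
Proof.
move=> r1 rs c0 mF0 F00 mF1 F10 cF.
have r0 i : (0 < r i)%R by apply: lt_le_trans (r1 i).
rewrite -/(shrunk r) (gaussian_tuple_scale r0 mF0 F00).
have mLF0 : measurable_fun setT (fun w => (LR r w)%:E * F0 (noise w)).
  apply: emeasurable_funM; first exact/measurable_EFinP.
  exact: measurableT_comp.
have mF1' : measurable_fun setT (fun w => F1 (noise w)).
  exact: measurableT_comp.
have LF0_ge0 w : 0 <= (LR r w)%:E * F0 (noise w).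
  by rewrite mule_ge0// lee_fin.
have mLR2 : measurable_fun setT (fun w => (LR r w ^+ 2)%:E).
  by apply/measurable_EFinP; exact: measurable_funX.
rewrite -ge0_integralD//; set S := (X in _ <= X).
have c4 : (0 <= c / 4)%R by rewrite divr_ge0.
have main : c%:E <= S + (c / 4)%:E * \int[P]_w (LR r w ^+ 2)%:E.
  rewrite -[leLHS]mule1 -(integral_LR r0) -ge0_integralZl//; last 2 first.
  - exact/measurable_EFinP.
  - by move=> w _; rewrite lee_fin.
  rewrite -ge0_integralZl//; last by move=> w _; rewrite lee_fin sqr_ge0.
  rewrite -ge0_integralD//; last 4 first.
  - by move=> w _; rewrite adde_ge0.
  - exact: emeasurable_funD.
  - by move=> w _; rewrite mule_ge0// lee_fin sqr_ge0.
  - exact: measurable_funeM.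
  apply: ge0_le_integral => //.
  - by move=> w _; rewrite -EFinM lee_fin mulr_ge0.
  - by apply/measurable_EFinP; exact: measurable_funM.
  - apply: emeasurable_funD; first exact: emeasurable_funD.
    exact: measurable_funeM.
  move=> w _; set l := LR r w; set y := noise w.
  have l0 : (0 <= l)%R by exact: LR_ge0.
  (* For l >= 1 the inequality 1 >= l - l^2 / 4 is (1 - l / 2)^2 >= 0. *)
  have [l1|l1] := leP l 1%R.
    rewrite muleC; apply: (@le_trans _ _ (l%:E * F0 y + F1 y)).
      apply: (@le_trans _ _ (l%:E * (F0 y + F1 y))).
        by rewrite lee_wpmul2l ?lee_fin.
      rewrite ge0_muleDr// leeD2l// -[leRHS]mul1e.
      by rewrite lee_wpmul2r// lee_fin.
    by rewrite leeDl// -EFinM lee_fin mulr_ge0// sqr_ge0.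
  apply: (@le_trans _ _ (c%:E + (c / 4)%:E * (l ^+ 2)%:E)).
    rewrite -!EFinM -EFinD lee_fin -subr_ge0.
    have -> : (c + c / 4 * l ^+ 2 - c * l = c * (1 - l / 2) ^+ 2)%R by field.
    by rewrite mulr_ge0// sqr_ge0.
  rewrite leeD2r//; apply: le_trans (cF y) _; rewrite leeD2r//.
  by rewrite -[leLHS]mul1e lee_wpmul2r// lee_fin ltW.
have : c%:E <= S + (c / 2)%:E.
  apply: le_trans main _; rewrite leeD2l//.
  apply: (@le_trans _ _ ((c / 4)%:E * 2%:E)).
    by rewrite lee_wpmul2l ?lee_fin// integral_sqr_LR.
  by rewrite -EFinM lee_fin; lra.
rewrite -leeBlDr// -EFinB.
by have -> : (c - c / 2 = c / 2)%R by field.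
Qed.

End gaussian_tuples.

(** * A compactly supported bump with bounded derivatives *)

Section quadratic_error.
Context (R : realType).

(** Gives the derivative of the squared positive part at 0 without comparing
    one-sided limits. *)
Lemma is_derive_quadratic_error (f : R -> R) (x l : R) :
  (forall h, `|f (x + h) - f x - h * l| <= h ^+ 2) -> is_derive x 1 f l.
Proof.
move=> H.
have cvgl :
    (fun h => h^-1 *: ((f \o shift x) (h *: (1 : R)) - f x)) @ 0^' --> l.
  apply/cvgrPdist_le => /= e e0; near=> h.
  have h0 : h != 0 by near: h; exact: nbhs_dnbhs_neq.
  rewrite /GRing.scale/= mulr1 (addrC h) distrC.
  have -> : h^-1 * (f (x + h) - f x) - l = h^-1 * (f (x + h) - f x - h * l).
    by field.
  rewrite normrM normfV ler_pdivrMl ?normr_gt0//; apply: le_trans (H h) _.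
  rewrite -real_normK ?num_real// expr2 ler_pM2l ?normr_gt0//.
  by near: h; exact: dnbhs0_le.
apply: DeriveDef; first exact: cvgP cvgl.
exact: cvg_lim.
Unshelve. all: by end_near. Qed.

Lemma pospart_expnS (e : nat) (t : R) :
  Num.max 0 t ^+ e.+2 = t * Num.max 0 t ^+ e.+1.
Proof.
by rewrite exprS; have [t0|t0] := leP 0 t; rewrite // expr0n/= !mulr0.
Qed.

Lemma is_derive_pospart_expn (e : nat) (x : R) :
  is_derive x 1 (fun t => Num.max 0 t ^+ e.+2) (e.+2%:R * Num.max 0 x ^+ e.+1).
Proof.
elim: e => [|e IH].
  apply: is_derive_quadratic_error => h; rewrite expr1 ler_norml.
  by case: (leP 0 x) => ?; case: (leP 0 (x + h)) => ?; apply/andP; split; nra.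
have -> : (fun t : R => Num.max 0 t ^+ e.+3) =
    (fun t => t * Num.max 0 t ^+ e.+2).
  by apply/funext => t; rewrite pospart_expnS.
have H := is_deriveM (is_derive_id x (1 : R)) IH.
refine (trigger_derive H _); rewrite /= /GRing.scale/= mulr1.
by rewrite mulrCA -pospart_expnS -[in RHS]natr1 [RHS]mulrDl mul1r.
Qed.

End quadratic_error.

Section bump.
Context (R : realType).
Implicit Types (N k : nat) (t : R).

(** The k-th derivative of (max 0 (t (1 - t)))^N is (max 0 (t (1 - t)))^(N - k)
    times this polynomial: each differentiation lowers the exponent of the
    positive part by one, and the function stays continuously differentiable as
    long as the exponent is at least 2. *)
Fixpoint bump_poly N k : {poly R} :=
  if k is k'.+1 then
    (N - k')%:R *: ((1 - 'X *+ 2) * bump_poly N k') +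
    'X * (1 - 'X) * (bump_poly N k')^`()
  else 1.

Definition bump_deriv N k t : R :=
  Num.max 0 (t * (1 - t)) ^+ (N - k) * (bump_poly N k).[t].

Lemma is_derive_bump N k t : (k.+2 <= N)%N ->
  is_derive t 1 (bump_deriv N k) (bump_deriv N k.+1 t).
Proof.
move=> kN; have [e Ne] : exists e, (N - k = e.+2)%N.
  exists (N - k - 2)%N; rewrite -addn2 subnK// leq_subRL ?addn2//.
  by rewrite ltnW// ltnW.
have Ne1 : (N - k.+1 = e.+1)%N by rewrite subnS Ne.
pose u := fun s : R => s * (1 - s).
have du : is_derive t 1 u (1 - t *+ 2).
  have H := is_deriveM (is_derive_id t 1)
    (is_deriveB (is_derive_cst (1 : R) t 1) (is_derive_id t 1)).
  refine (trigger_derive H _); rewrite /GRing.scale/=.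
  by rewrite -[(cst 1 - id) t]/(1 - t); ring.
have dp : is_derive t 1 (fun s => Num.max 0 (u s) ^+ e.+2)
    (e.+2%:R * Num.max 0 (u t) ^+ e.+1 * (1 - t *+ 2)).
  exact: (is_derive1_comp (is_derive_pospart_expn e (u t)) du).
have H := is_deriveM dp (is_derive_poly (bump_poly N k) t).
rewrite /bump_deriv Ne Ne1.
refine (trigger_derive H _).
rewrite /= Ne !hornerE /GRing.scale/= -/(u t).
by rewrite pospart_expnS /u; ring.
Qed.

Lemma bump_deriv_eq0 N k t : (k < N)%N -> ~~ (0 < t < 1) ->
  bump_deriv N k t = 0.
Proof.
move=> kN t01; rewrite /bump_deriv max_l ?expr0n.
  by rewrite subn_eq0 leqNgt kN mul0r.
by move: t01; rewrite negb_and -!leNgt => /orP[] h; nra.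
Qed.

Lemma bump_deriv_bounded N : exists2 B : R, 0 < B &
  forall k t, (k < N)%N -> `|bump_deriv N k t| <= B.
Proof.
have bnd1 k : exists2 B : R, 0 <= B &
    forall t, (k < N)%N -> `|bump_deriv N k t| <= B.
  exists (\sum_(i < size (bump_poly N k)) `|(bump_poly N k)`_i|).
    exact: sumr_ge0.
  move=> t kN; have [t01|t01] := boolP (0 < t < 1); last first.
    by rewrite bump_deriv_eq0// normr0 sumr_ge0.
  have /andP[t0 t1] := t01.
  rewrite /bump_deriv normrM -[leRHS]mul1r ler_pM//.
    rewrite normrX exprn_ile1// ger0_norm ?le_max ?lexx// ge_max ler01/=.
    by nra.
  rewrite horner_coef; apply: le_trans (ler_norm_sum _ _ _) _.
  apply: ler_sum => i _; rewrite normrM ler_piMr// normrX exprn_ile1//.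
  by rewrite gtr0_norm// ltW.
have /choice[B0 HB] : forall k, exists B0 : R, 0 <= B0 /\
    forall t, (k < N)%N -> `|bump_deriv N k t| <= B0.
  by move=> k; have [B] := bnd1 k; exists B.
exists (1 + \sum_(k < N) B0 k).
  by rewrite ltr_pwDl// sumr_ge0// => k _; exact: (HB k).1.
move=> k t kN; apply: le_trans ((HB k).2 t kN) _.
rewrite (bigD1 (Ordinal kN))//= addrCA lerDl addr_ge0//.
by rewrite sumr_ge0// => j _; exact: (HB j).1.
Qed.

Lemma bump_ge0 N t : 0 <= bump_deriv N 0 t.
Proof. by rewrite /bump_deriv hornerC mulr1 exprn_ge0// le_max lexx. Qed.

Lemma bump_center N t : 4^-1 <= t <= 3 / 4 -> (3 / 16) ^+ N <= bump_deriv N 0 t.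
Proof.
move=> /andP[t1 t2]; rewrite /bump_deriv hornerC mulr1 subn0 lerXn2r ?nnegrE//.
- by rewrite le_max lexx.
- by rewrite le_max; apply/orP; right; nra.
Qed.

Lemma bump_deriv_lipschitz N k (B : R) s t : (k.+2 <= N)%N ->
  (forall u, `|bump_deriv N k.+1 u| <= B) ->
  `|bump_deriv N k s - bump_deriv N k t| <= B * `|s - t|.
Proof.
move=> kN HB; wlog st : s t / s <= t => [H|].
  by have [/H//|/ltW/H] := leP s t; rewrite distrC (distrC t).
rewrite distrC (distrC s).
have [|c _ ->] := MVT_segment st (fun u _ => is_derive_bump u kN).
  apply: continuous_subspaceT => u; apply/differentiable_continuous.
  by apply/derivable1_diffP; have [] := is_derive_bump u kN.
by rewrite normrM ler_wpM2r.
Qed.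

(** At distance at most 1 the Lipschitz bound dominates since a <= 1, and at
    larger distance the uniform bound does. *)
Lemma bump_deriv_holder N k (B a : R) s t : (k.+2 <= N)%N ->
  (forall u, `|bump_deriv N k u| <= B) ->
  (forall u, `|bump_deriv N k.+1 u| <= B) -> 0 < a <= 1 ->
  `|bump_deriv N k s - bump_deriv N k t| <= 2 * B * `|s - t| `^ a.
Proof.
move=> kN HB0 HB1 /andP[a0 a1].
have B0 : 0 <= B by apply: le_trans (HB0 0).
have [st|st] := leP `|s - t| 1.
  apply: le_trans (bump_deriv_lipschitz s t kN HB1) _.
  have [->|st0] := eqVneq `|s - t| 0.
    by rewrite mulr0 mulr_ge0 ?powR_ge0// mulr_ge0.
  have h : `|s - t| <= `|s - t| `^ a.
    rewrite -[leLHS]powRr1//; apply: ger_powR => //.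
    by rewrite st lt0r st0 normr_ge0.
  apply: le_trans (ler_wpM2l B0 h) _.
  by rewrite ler_wpM2r ?powR_ge0// ler_peMl// ler1n.
apply: (@le_trans _ _ (2 * B)).
  apply: le_trans (ler_normB _ _) _.
  by rewrite mulr_natl mulr2n lerD.
rewrite ler_peMr ?mulr_ge0//.
have := @ge0_ler_powR R a (ltW a0) 1 `|s - t|; rewrite powR1; apply.
- by rewrite nnegrE.
- by rewrite nnegrE.
- exact: ltW.
Qed.

Lemma continuous_bump N : (2 <= N)%N -> continuous (bump_deriv N 0).
Proof.
move=> N2 t; apply/differentiable_continuous/derivable1_diffP.
by have [] := is_derive_bump t N2.
Qed.

End bump.

(** * Perturbed variance functions in the Hoelder class *)

Section bump_train.
Context (R : realType) (N M : nat).
Implicit Types (j : 'I_M) (k : nat) (theta : {ffun 'I_M -> bool}) (x : R).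

Definition in_cell j x : bool := 0 < M%:R * x - j%:R < 1.

(** Disjointness of the cells, in the form in which sums over cells use it. *)
Lemma sum_in_cell_le1 x : \sum_j (in_cell j x)%:R <= 1 :> R.
Proof.
have [/existsP[j jx]|/existsPn h] := boolP [exists j, in_cell j x]; last first.
  by rewrite big1// => j _; rewrite (negbTE (h j)).
rewrite (bigD1 j)//= jx big1 ?addr0// => i ij.
suff /negbTE-> : ~~ in_cell i x by [].
apply: contra ij => ix; apply/eqP/val_inj => /=.
move: ix jx => /andP[i0 i1] /andP[j0 j1].
have h1 : i%:R < j.+1%:R :> R by rewrite -natr1; lra.
have h2 : j%:R < i.+1%:R :> R by rewrite -natr1; lra.
by move: h1 h2; rewrite !ltr_nat !ltnS => h1 h2; apply/eqP; rewrite eqn_leq h1.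
Qed.

Definition bump_train k theta x : R :=
  \sum_j (theta j)%:R * bump_deriv N k (M%:R * x - j%:R).

Lemma is_derive_bump_train k theta x : (k.+2 <= N)%N ->
  is_derive x 1 (bump_train k theta) (M%:R * bump_train k.+1 theta x).
Proof.
move=> kN.
have dj j : is_derive x 1
    (fun y => (theta j)%:R * bump_deriv N k (M%:R * y - j%:R))
    ((theta j)%:R * (bump_deriv N k.+1 (M%:R * x - j%:R) * M%:R)).
  have da : is_derive x 1 (fun y : R => M%:R * y - j%:R) M%:R.
    have H := is_deriveB (is_deriveZ M%:R (is_derive_id x (1 : R)))
      (is_derive_cst (j%:R : R) x 1).
    by refine (trigger_derive H _); rewrite subr0 /GRing.scale/= mulr1.
  have H := @is_derive1_comp R (bump_deriv N k) (fun y => M%:R * y - j%:R) x _ _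
    (is_derive_bump (M%:R * x - j%:R) kN) da.
  exact: is_deriveZ.
have H := is_derive_sum dj.
have -> : bump_train k theta =
    \sum_j (fun y => (theta j)%:R * bump_deriv N k (M%:R * y - j%:R)).
  by apply/funext => y; rewrite fct_sumE.
refine (trigger_derive H _); rewrite mulr_sumr; apply: eq_bigr => j _.
by rewrite /GRing.scale/= mulrA mulrC.
Qed.

Lemma bump_train_bounded k theta x (B : R) : (k < N)%N ->
  (forall t, `|bump_deriv N k t| <= B) -> `|bump_train k theta x| <= B.
Proof.
move=> kN HB; have B0 : 0 <= B by apply: le_trans (HB 0).
apply: le_trans (ler_norm_sum _ _ _) _.
apply: (@le_trans _ _ (\sum_j (in_cell j x)%:R * B)).
  apply: ler_sum => j _; rewrite normrM.
  have [jx|jx] := boolP (in_cell j x); last first.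
    by rewrite bump_deriv_eq0// normr0 mulr0 mul0r.
  by rewrite mul1r; case: (theta j); rewrite ?normr1 ?normr0 ?mul1r ?mul0r.
by rewrite -mulr_suml ler_piMl// sum_in_cell_le1.
Qed.

(** Only the cells of s and of t contribute to the difference, hence a constant
    independent of the number of cells. *)
Lemma bump_train_holder k theta s t (B a : R) : (k.+2 <= N)%N ->
  (forall u, `|bump_deriv N k u| <= B) ->
  (forall u, `|bump_deriv N k.+1 u| <= B) -> 0 < a <= 1 ->
  `|bump_train k theta s - bump_train k theta t| <=
    4 * B * (M%:R `^ a * `|s - t| `^ a).
Proof.
move=> kN HB0 HB1 a01; have kN1 : (k < N)%N by apply: ltn_trans kN.
have B0 : 0 <= B by apply: le_trans (HB0 0).
set D := _ * `|s - t| `^ a.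
have D0 : 0 <= D by rewrite mulr_ge0 ?powR_ge0.
rewrite /bump_train -sumrB; apply: le_trans (ler_norm_sum _ _ _) _.
apply: (@le_trans _ _
    (\sum_j ((in_cell j s)%:R + (in_cell j t)%:R) * (2 * B * D))).
  apply: ler_sum => j _; rewrite -mulrBr normrM.
  have h : `|bump_deriv N k (M%:R * s - j%:R) -
      bump_deriv N k (M%:R * t - j%:R)| <= 2 * B * D.
    apply: le_trans (bump_deriv_holder _ _ kN HB0 HB1 a01) _.
    rewrite opprB addrA subrK -mulrBr normrM powRM// ger0_norm//.
  have th : `|(theta j)%:R| <= 1 :> R.
    by case: (theta j); rewrite ?normr1 ?normr0.
  have [js|js] := boolP (in_cell j s); have [jt|jt] := boolP (in_cell j t).
  - by apply: ler_pM => //; apply: le_trans th _; rewrite lerDl.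
  - by rewrite addr0; exact: ler_pM.
  - by rewrite add0r; exact: ler_pM.
  - by rewrite !bump_deriv_eq0// subr0 normr0 mulr0 addr0 mul0r.
rewrite -mulr_suml big_split/=.
have -> : 4 * B * D = 2 * (2 * B * D) by ring.
rewrite ler_wpM2r//; first by rewrite mulr_ge0// mulr_ge0.
by have := sum_in_cell_le1 s; have := sum_in_cell_le1 t; lra.
Qed.

Lemma bump_train_ge0 theta x : 0 <= bump_train 0 theta x.
Proof. by apply: sumr_ge0 => j _; rewrite mulr_ge0// bump_ge0. Qed.

Definition bump_variance delta A theta x : R :=
  delta + A * bump_train 0 theta x.

Lemma derive1n_bump_variance (delta A : R) theta k : (k < N)%N ->
  (bump_variance delta A theta)^`(k)%classic = (fun x =>
    (k == 0%N)%:R * delta + A * (M%:R ^+ k * bump_train k theta x)).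
Proof.
elim: k => [_|k IH kN]; first by apply/funext => x; rewrite mul1r mul1r.
rewrite derive1nS IH 1?ltnW//; apply/funext => x; rewrite derive1E.
have H := is_deriveD (is_derive_cst ((k == 0%N)%:R * delta) x 1)
  (is_deriveZ A (is_deriveZ (M%:R ^+ k) (is_derive_bump_train theta x kN))).
rewrite (derive_val (is_derive := H)).
by rewrite mul0r !add0r /GRing.scale/= exprSr !mulrA.
Qed.

End bump_train.

Section holder_membership.
Context (R : realType).

Lemma strict_floor_lt (c : R) : 0 < c -> (strict_floor c)%:R < c.
Proof. by move=> c0; rewrite strict_floorP. Qed.

Lemma le_strict_floorS (c : R) : 0 < c -> c <= (strict_floor c).+1%:R.
Proof. by move=> c0; rewrite leNgt strict_floorP// ltnn. Qed.

Lemma holder_class0 (C1 C2 c : R) : 0 < C1 -> 0 < C2 ->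
  holder_class C1 C2 c (fun=> 0).
Proof.
move=> C10 C20; have d0 k : (fun=> 0 : R)^`(k)%classic = (fun=> 0 : R).
  by elim: k => [//|k IH]; rewrite derive1nS IH; apply/funext => x;
     rewrite derive1_cst.
split=> [k x _ _|x y _ _|k x _ _]; rewrite d0.
- exact: derivable_cst.
- by rewrite subrr normr0 mulr_ge0 ?powR_ge0// ltW.
- by rewrite normr0 ltW.
Qed.

(** Each derivative of order k costs a factor M^k and the Hoelder quotient a
    further M^(c - m), so A M^c is the quantity to keep bounded.  The value
    itself is bounded through delta + A B, a constraint that only appears when
    m > 0. *)
Lemma bump_variance_holder (C1 C2 c delta A B : R) (M : nat)
    (theta : {ffun 'I_M -> bool}) (m := strict_floor c) :
  0 < c -> (0 < M)%N -> 0 <= delta -> 0 <= A ->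
  (forall k t, (k < m.+2)%N -> `|bump_deriv m.+2 k t| <= B) ->
  A * M%:R `^ c * (4 * B) <= C1 ->
  A * M%:R `^ c * B <= C2 ->
  ((0 < m)%N -> delta + A * B <= C2) ->
  holder_class_pos C1 C2 c delta (bump_variance m.+2 delta A theta).
Proof.
move=> c0 M0 delta0 A0 HB hC1 hC2 hC2'.
have mc : m%:R < c by exact: strict_floor_lt.
have cm : c <= m.+1%:R by exact: le_strict_floorS.
have B0 : 0 <= B by apply: le_trans (HB 0%N 0 isT).
have M1 : 1 <= M%:R :> R by rewrite ler1n.
split; last first.
  by move=> x _; rewrite lerDl mulr_ge0// bump_train_ge0.
split=> [k x km _|x y _ _|k x km _].
- rewrite derive1n_bump_variance; last by rewrite (ltn_trans km).
  have km2 : (k.+2 <= m.+2)%N by rewrite !ltnS ltnW.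
  have H := is_deriveD (is_derive_cst ((k == 0%N)%:R * delta) x 1)
    (is_deriveZ A (is_deriveZ (M%:R ^+ k) (is_derive_bump_train theta x km2))).
  by have [] := H.
- rewrite derive1n_bump_variance// opprD addrACA subrr add0r -mulrBr -mulrBr.
  rewrite normrM ger0_norm// normrM ger0_norm ?exprn_ge0//.
  have a01 : 0 < c - m%:R <= 1.
    by rewrite subr_gt0 mc/= lerBlDr addrC natr1.
  have h := bump_train_holder theta x y (leqnn m.+2)
    (fun u => HB m u (leqnSn _)) (fun u => HB m.+1 u (leqnn _)) a01.
  have Mh : 0 <= M%:R ^+ m :> R by rewrite exprn_ge0.
  apply: le_trans (ler_wpM2l A0 (ler_wpM2l Mh h)) _.
  rewrite mulrA [A * _]mulrC -!mulrA.
  have -> : M%:R ^+ m * (A * (4 * (B * (M%:R `^ (c - m%:R) *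
      `|x - y| `^ (c - m%:R))))) =
      A * (M%:R `^ (c - m%:R) * M%:R ^+ m) * (4 * B) * `|x - y| `^ (c - m%:R).
    by ring.
  rewrite -powR_mulrn// -powRD ?subrK; last first.
    by apply/implyP => _; rewrite pnatr_eq0 -lt0n.
  by rewrite ler_wpM2r ?powR_ge0.
- rewrite derive1n_bump_variance; last by rewrite (ltn_trans km).
  have bk : `|bump_train m.+2 k theta x| <= B.
    have km2 : (k < m.+2)%N by rewrite (ltn_trans km).
    by apply: bump_train_bounded => // t; exact: HB.
  have [k0|k0] := eqVneq k 0%N.
    rewrite k0 expr0 !mul1r -k0; apply: le_trans (ler_normD _ _) _.
    rewrite ger0_norm// normrM (ger0_norm A0).
    apply: le_trans (hC2' (leq_ltn_trans (leq0n _) km)).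
    by rewrite lerD2l ler_wpM2l.
  rewrite mul0r add0r normrM (ger0_norm A0) normrM ger0_norm ?exprn_ge0//.
  apply: le_trans hC2; rewrite -mulrA ler_wpM2l// ler_pM ?exprn_ge0//.
  rewrite -powR_mulrn// ler_powR// (le_trans _ (ltW mc))//.
  by rewrite ler_nat ltnW.
Qed.

End holder_membership.

(** * Averaging over the hypercube *)

Section assouad.
Context (R : realType) (M : nat).
Local Notation bits := {ffun 'I_M -> bool}.
Implicit Types (theta : bits) (j : 'I_M).

Definition flip j theta : bits :=
  [ffun i => (i == j) (+) theta i].

Lemma flipK j : involutive (flip j).
Proof. by move=> theta; apply/ffunP => i; rewrite !ffunE addKb. Qed.

Local Open Scope ereal_scope.

(** The worst risk is at least the average risk over the hypercube; in that
    average theta and its neighbour across edge j have equal weights. *)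
Lemma assouad (G : 'I_M -> bits -> \bar R)
    (risk : bits -> \bar R) (e : 'I_M -> R) (S : \bar R) :
  (forall j theta, 0 <= G j theta) ->
  (forall theta, \sum_j G j theta <= risk theta) ->
  (forall j theta, (e j)%:E <= G j theta + G j (flip j theta)) ->
  (forall theta, risk theta <= S) -> ((\sum_j e j) / 2)%:E <= S.
Proof.
move=> G0 GR eG RS.
have GS theta : \sum_j G j theta <= S by apply: le_trans (GR theta) (RS theta).
case: S => [s||] in RS GS *; last 2 first.
- exact: leey.
- have := GS [ffun=> false]; rewrite leNgt => /negP[].
  by apply: lt_le_trans (sume_ge0 _ _) => //; exact: ltNyr.
have key : \sum_(theta : bits) \sum_j (e j)%:E <=
    \sum_(theta : bits) s%:E + \sum_(theta : bits) s%:E.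
  apply: (@le_trans _ _
      (\sum_(theta : bits) \sum_j G j theta +
       \sum_(theta : bits) \sum_j G j (flip j theta))%E).
    rewrite -big_split/=; apply: lee_sum => theta _.
    by rewrite -big_split/=; apply: lee_sum.
  apply: leeD; first exact: lee_sum.
  rewrite exchange_big/=.
  rewrite (_ : \sum_(j < M) _ = \sum_j \sum_(theta : bits) G j theta).
    by rewrite exchange_big/=; exact: lee_sum.
  apply: eq_bigr => j _.
  by rewrite [RHS](reindex_inj (inv_inj (flipK j))).
move: key; under eq_bigr do rewrite sumEFin.
rewrite !sumEFin lee_fin !sumr_const.
rewrite -mulrnDl lerMn2r => /orP[|h].
  by move=> /eqP/card0_eq/(_ [ffun=> false]).
by rewrite lee_fin ler_pdivrMr// mulr_natr mulr2n.
Qed.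

End assouad.

(** * Loss on one cell *)

Section weighted_loss.
Context (R : realType) (n : nat) (Vt : n.-tuple R -> R -> R).
Hypothesis Vt_estimator : estimator Vt.
Local Notation mu := (@lebesgue_measure R).
Local Open Scope ereal_scope.

(** With w = 1 this is the full integrated squared error, and with w the
    indicator of a cell the loss on that cell. *)
Definition weighted_loss (w v : R -> R) (y : n.-tuple R) : \bar R :=
  \int[mu]_(t in `[0%R, 1%R]) (w t * (Vt y t - v t) ^+ 2)%:E.

Lemma weighted_loss_ge0 w v y : (forall t, 0 <= w t)%R ->
  0 <= weighted_loss w v y.
Proof.
by move=> w0; apply: integral_ge0 => t _; rewrite lee_fin mulr_ge0// sqr_ge0.
Qed.

Let D : set (n.-tuple R * R) := [set: n.-tuple R] `*` (`[0%R, 1%R] : set R).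

Let mD : measurable D.
Proof. by apply: measurableX => //; exact: measurable_itv. Qed.

Let measurable_integrand (w v : R -> R) :
  measurable_fun setT w -> measurable_fun setT v ->
  measurable_fun D (fun z => (w z.2 * (Vt z.1 z.2 - v z.2) ^+ 2)%:E).
Proof.
move=> mw mv; apply/measurable_EFinP; apply: measurable_funM.
  by apply: measurable_funTS; exact: measurableT_comp.
apply: measurable_funX; apply: measurable_funB; first exact: Vt_estimator.
by apply: measurable_funTS; exact: measurableT_comp.
Qed.

(** An estimator is only measurable on [0, 1] in its second argument, whereas
    Tonelli's theorem wants a function on the whole product. *)
Let integrand_patch (w v : R -> R) y :
  (fun t => ((fun z => (w z.2 * (Vt z.1 z.2 - v z.2) ^+ 2)%:E) \_ D) (y, t)) =
  (fun t => (w t * (Vt y t - v t) ^+ 2)%:E) \_ (`[0%R, 1%R]%classic : set R).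
Proof.
apply/funext => t; rewrite !patchE.
have -> // : ((y, t) \in D) = (t \in (`[0%R, 1%R]%classic : set R)).
by apply/idP/idP; rewrite !inE; [move=> []|split].
Qed.

Lemma measurable_weighted_loss_integrand (w v : R -> R) y :
  measurable_fun setT w -> measurable_fun setT v ->
  measurable_fun (`[0%R, 1%R]%classic : set (measurableTypeR R))
    (fun t => (w t * (Vt y t - v t) ^+ 2)%:E).
Proof.
move=> mw mv; apply/measurable_restrictT; first exact: measurable_itv.
rewrite -integrand_patch.
apply: (measurableT_comp ((measurable_restrictT _ mD).1
  (measurable_integrand mw mv))).
exact: measurable_pair1.
Qed.

Lemma measurable_weighted_loss (w v : R -> R) : (forall t, 0 <= w t)%R ->
  measurable_fun setT w -> measurable_fun setT v ->
  measurable_fun setT (weighted_loss w v).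
Proof.
move=> w0 mw mv.
have mf := (measurable_restrictT _ mD).1 (measurable_integrand mw mv).
set f := (X in measurable_fun setT X) in mf.
have f0 z : 0 <= f z.
  rewrite /f patchE; case: ifP => // _; rewrite lee_fin mulr_ge0//.
  exact: sqr_ge0.
rewrite (_ : weighted_loss w v = fun y => \int[mu]_t f (y, t)).
  apply: (@measurable_fun_fubini_tonelli_F _ _ (n.-tuple R) (measurableTypeR R)
    R mu f) => //.
apply/funext => y; rewrite /weighted_loss integral_mkcond.
by rewrite -integrand_patch.
Qed.

End weighted_loss.

Section cell_losses.
Context (R : realType) (n N M : nat) (Vt : n.-tuple R -> R -> R).
Hypothesis Vt_estimator : estimator Vt.
Hypothesis N_ge2 : (2 <= N)%N.
Hypothesis M_gt0 : (0 < M)%N.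
Variables (delta A : R).
Hypothesis A_ge0 : 0 <= A.
Implicit Types (j : 'I_M) (theta : {ffun 'I_M -> bool}) (t : R).
Local Notation mu := (@lebesgue_measure R).

Lemma measurable_in_cell j :
  measurable_fun setT (fun t : R => (in_cell j t)%:R : R).
Proof.
rewrite (_ : (fun t => _) =
    (\1_(`]0, 1[%classic) : R -> R) \o (fun t => M%:R * t - j%:R)).
  apply: measurableT_comp; first exact: measurable_indic.
  by apply: measurable_funB => //; exact: measurable_funM.
by apply/funext => t /=; rewrite indicE mem_setE in_itv.
Qed.

Lemma measurable_bump : measurable_fun setT (bump_deriv N 0 : R -> R).
Proof. by apply: continuous_measurable_fun; exact: continuous_bump. Qed.

Definition cell_variance j (b : bool) (t : R) : R :=
  delta + A * (b%:R * bump_deriv N 0 (M%:R * t - j%:R)).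

Lemma measurable_cell_variance j b : measurable_fun setT (cell_variance j b).
Proof.
apply: measurable_funD => //; apply: measurable_funM => //.
apply: measurable_funM => //.
apply: measurableT_comp; first exact: measurable_bump.
by apply: measurable_funB => //; exact: measurable_funM.
Qed.

Lemma bump_train_in_cell j theta t : in_cell j t ->
  bump_train N 0 theta t = (theta j)%:R * bump_deriv N 0 (M%:R * t - j%:R).
Proof.
move=> jt; rewrite /bump_train (bigD1 j)//= big1 ?addr0// => i ij.
rewrite bump_deriv_eq0 ?mulr0 ?(ltnW N_ge2)//.
apply/negP => it; have := sum_in_cell_le1 M t.
have {}it : in_cell i t by [].
rewrite (bigD1 j)//= jt (bigD1 i)//= it.
have : 0 <= \sum_(k < M | (k != j) && (k != i)) (in_cell k t)%:R :> R.
  exact: sumr_ge0.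
set S := \sum_(_ < _ | _) _ => S0; rewrite -[true%:R]/(1 : R) => h; lra.
Qed.

Lemma bump_variance_in_cell j theta t : in_cell j t ->
  bump_variance N delta A theta t = cell_variance j (theta j) t.
Proof. by move=> jt; rewrite /bump_variance (bump_train_in_cell _ jt). Qed.

Lemma measurable_bump_variance theta :
  measurable_fun setT (bump_variance N delta A theta).
Proof.
apply: measurable_funD => //; apply: measurable_funM => //.
apply: measurable_sum => j; apply: measurable_funM => //.
apply: measurableT_comp; first exact: measurable_bump.
by apply: measurable_funB => //; exact: measurable_funM.
Qed.

Local Open Scope ereal_scope.

Definition cell_loss j b : n.-tuple R -> \bar R :=
  weighted_loss Vt (fun t => (in_cell j t)%:R) (cell_variance j b).

Lemma cell_loss_ge0 j b y : 0 <= cell_loss j b y.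
Proof. exact: weighted_loss_ge0. Qed.

Lemma measurable_cell_loss j b : measurable_fun setT (cell_loss j b).
Proof.
apply: measurable_weighted_loss => //; first exact: measurable_in_cell.
exact: measurable_cell_variance.
Qed.

Lemma sum_cell_loss_le theta y :
  \sum_j cell_loss j (theta j) y <=
  \int[mu]_(t in `[0%R, 1%R])
    ((Vt y t - bump_variance N delta A theta t) ^+ 2)%:E.
Proof.
have m1 : measurable_fun setT (cst 1%R : R -> R) by [].
have mV := measurable_weighted_loss_integrand Vt_estimator y m1
  (measurable_bump_variance theta).
under [leRHS]eq_integral do rewrite -[X in X%:E]mul1r.
rewrite /cell_loss /weighted_loss -ge0_integral_sum//=; last 2 first.
- move=> j; apply: measurable_weighted_loss_integrand => //.
    exact: measurable_in_cell.
  exact: measurable_cell_variance.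
- by move=> j t _; rewrite lee_fin mulr_ge0// sqr_ge0.
apply: ge0_le_integral => //=.
- by move=> t _; apply: sume_ge0 => j _; rewrite lee_fin mulr_ge0// sqr_ge0.
- apply: emeasurable_sum => j; apply: measurable_weighted_loss_integrand => //.
    exact: measurable_in_cell.
  exact: measurable_cell_variance.
move=> t _; rewrite sumEFin lee_fin.
rewrite (eq_bigr (fun j => (in_cell j t)%:R *
    (Vt y t - bump_variance N delta A theta t) ^+ 2)%R).
  by rewrite -mulr_suml ler_wpM2r ?sqr_ge0// sum_in_cell_le1.
move=> j _; have [jt|] := boolP (in_cell j t); last by rewrite !mul0r.
by rewrite (bump_variance_in_cell _ jt).
Qed.

(** The middle half of the cell, of length 1 / (2 M), suffices: there the bump
    is at least (3/16)^N. *)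
Lemma cell_separation j y :
  (A ^+ 2 * (3 / 16) ^+ N ^+ 2 / (4 * M%:R))%:E <=
  cell_loss j false y + cell_loss j true y.
Proof.
have M0 : (0 < M%:R :> R)%R by rewrite ltr0n.
have mI b := measurable_weighted_loss_integrand Vt_estimator y
  (measurable_in_cell j) (measurable_cell_variance j b).
rewrite /cell_loss /weighted_loss -ge0_integralD//=; last 2 first.
- by move=> t _; rewrite lee_fin mulr_ge0// sqr_ge0.
- by move=> t _; rewrite lee_fin mulr_ge0// sqr_ge0.
set lo : R := ((j%:R + 4^-1) / M%:R)%R; set hi : R := ((j%:R + 3 / 4) / M%:R)%R.
set c : R := (A ^+ 2 * (3 / 16) ^+ N ^+ 2 / 2)%R.
have jM : (j%:R + 1 <= M%:R :> R)%R by rewrite natr1 ler_nat.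
have j0 : (0 <= j%:R :> R)%R by [].
have lo0 : (0 <= lo)%R by rewrite divr_ge0// addr_ge0.
have hi1 : (hi <= 1)%R by rewrite ler_pdivrMr//; lra.
have c0 : (0 <= c)%R by rewrite divr_ge0// mulr_ge0// sqr_ge0.
apply: (@le_trans _ _ (\int[mu]_(t in `[0%R, 1%R])
  (c * \1_(`[lo, hi]%classic) t)%:E)).
  under eq_integral do rewrite EFinM.
  rewrite ge0_integralZl//=; last first.
    by apply/measurable_EFinP; exact: measurable_indic.
  rewrite integral_indic// setIidl; last first.
    by apply: subset_itv; rewrite bnd_simp.
  rewrite /= lebesgue_measure_itv/= lte_fin.
  rewrite ltr_pM2r ?invr_gt0// ltrD2l ifT; last by lra.
  rewrite -EFinB -EFinM lee_fin /c /lo /hi le_eqVlt; apply/orP; left; apply/eqP.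
  by field; rewrite gt_eqF.
apply: ge0_le_integral => //=.
- by move=> t _; rewrite lee_fin mulr_ge0.
- by apply/measurable_EFinP; exact: measurable_funM.
- exact: emeasurable_funD.
move=> t _; rewrite -EFinD lee_fin indicE mem_setE in_itv/=.
have [/andP[lot thi]|_] := boolP (lo <= t <= hi)%R; last first.
  by rewrite mulr0 addr_ge0// mulr_ge0// sqr_ge0.
move: lot thi; rewrite /lo /hi ler_pdivrMr// ler_pdivlMr// => lot thi.
have -> : in_cell j t by apply/andP; split; lra.
rewrite mulr1 !mul1r /cell_variance.
have q : ((3 / 16) ^+ N <= bump_deriv N 0 (M%:R * t - j%:R) :> R)%R.
  by apply: bump_center; apply/andP; split; lra.
rewrite mul0r mulr0 addr0 mul1r.
move: q; set q := (_ ^+ N)%R; set f := bump_deriv _ _ _ => qf.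
have q0 : (0 <= q)%R by rewrite exprn_ge0// divr_ge0.
have qf2 : (A ^+ 2 * q ^+ 2 <= (A * f) ^+ 2)%R.
  by rewrite exprMn ler_wpM2l ?sqr_ge0// lerXn2r// nnegrE (le_trans q0).
(* x^2 + (x - z)^2 = 2 (x - z / 2)^2 + z^2 / 2 *)
apply: (@le_trans _ _ ((A * f) ^+ 2 / 2))%R; first by rewrite ler_pM2r.
rewrite -subr_ge0; have -> : ((Vt y t - delta) ^+ 2 +
    (Vt y t - (delta + A * f)) ^+ 2 - (A * f) ^+ 2 / 2 =
    2 * (Vt y t - delta - A * f / 2) ^+ 2)%R by field.
by rewrite mulr_ge0// sqr_ge0.
Qed.

End cell_losses.

(** * Two neighbouring variance functions cannot be told apart *)

Section cell_two_point.
Context d (T : measurableType d) (R : realType) (P : probability T R) (n : nat).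
Variables (X : 'I_n -> {RV P >-> R}) (p : 'I_n -> R).
Hypothesis X_indep : mutually_independent X.
Hypothesis X_normal : forall i, standard_normal (X i).
Variables (N M : nat) (Vt : n.-tuple R -> R -> R).
Hypothesis Vt_estimator : estimator Vt.
Hypothesis N_ge2 : (2 <= N)%N.
Hypothesis M_gt0 : (0 < M)%N.
Variables (delta A B : R).
Hypothesis delta_gt0 : 0 < delta.
Hypothesis A_ge0 : 0 <= A.
Hypothesis bump_leB : forall t, `|bump_deriv N 0 t| <= B.
Implicit Types (j : 'I_M) (theta : {ffun 'I_M -> bool}).

Let V theta : R -> R := bump_variance N delta A theta.

Definition noisy_data (v : R -> R) (w : T) : n.-tuple R :=
  [tuple Num.sqrt (v (p i)) * X i w | i < n].

Lemma measurable_noisy_data v : measurable_fun setT (noisy_data v).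
Proof.
apply/measurable_fun_tnthP => i.
rewrite (_ : _ \o _ = fun w => Num.sqrt (v (p i)) * X i w).
  exact: measurable_funM.
by apply/funext => w /=; rewrite tnth_mktuple.
Qed.

Definition cell_count j : R := \sum_i (in_cell j (p i))%:R.

Lemma sum_cell_count : \sum_j cell_count j <= n%:R.
Proof.
rewrite exchange_big/=; apply: (@le_trans _ _ (\sum_(i < n) 1)).
  by apply: ler_sum => i _; exact: sum_in_cell_le1.
by rewrite sumr_const card_ord.
Qed.

Let V_ge theta t : delta <= V theta t.
Proof. by rewrite lerDl mulr_ge0// bump_train_ge0. Qed.

Let V_flip j theta t : theta j = false ->
  V (flip j theta) t = V theta t + A * bump_deriv N 0 (M%:R * t - j%:R).
Proof.
move=> tj; rewrite /V /bump_variance -addrA -mulrDr; congr (_ + _ * _).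
rewrite /bump_train (bigD1 j)//= [in RHS](bigD1 j)//= ffunE eqxx tj.
rewrite mul1r mul0r add0r addrC; congr (_ + _); apply: eq_bigr => i ij.
by rewrite ffunE (negbTE ij).
Qed.

Local Open Scope ereal_scope.

(** Multiplication by the larger standard deviations sends the noise to the data
    under [flip j theta], and the noise shrunk by sqrt(r_i) to the data under
    theta, which is the situation of [gaussian_two_point]. *)
Let cell_two_point_false j theta : theta j = false ->
  ((A * B / delta) ^+ 2 * cell_count j <= 1)%R ->
  (A ^+ 2 * (3 / 16) ^+ N ^+ 2 / (4 * M%:R) / 2)%:E <=
  \int[P]_w cell_loss N Vt delta A j false (noisy_data (V theta) w) +
  \int[P]_w cell_loss N Vt delta A j true (noisy_data (V (flip j theta)) w).
Proof.
move=> tj cnt.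
pose V0 i := V theta (p i); pose V1 i := V (flip j theta) (p i).
have V0_gt0 i : (0 < V0 i)%R by apply: lt_le_trans (V_ge _ _).
have V1_gt0 i : (0 < V1 i)%R by apply: lt_le_trans (V_ge _ _).
pose r i : R := (V1 i / V0 i)%R.
have rE i : (r i - 1 = A * bump_deriv N 0 (M%:R * p i - j%:R) / V0 i)%R.
  rewrite /r /V1 (V_flip (p i) tj) -/(V0 i) mulrDl mulfV ?gt_eqF//.
  by rewrite addrAC subrr add0r.
have r1 i : (1 <= r i)%R.
  rewrite -subr_ge0 rE divr_ge0 ?(ltW (V0_gt0 i))//.
  by rewrite mulr_ge0// bump_ge0.
have rs : (\sum_i (r i - 1) ^+ 2 <= 1)%R.
  apply: le_trans cnt; rewrite mulr_sumr; apply: ler_sum => i _; rewrite rE.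
  have [ij|ij] := boolP (in_cell j (p i)); last first.
    by rewrite bump_deriv_eq0 ?(ltnW N_ge2)// mulr0 mul0r expr0n mulr0.
  rewrite mulr1 lerXn2r ?nnegrE//.
  - by rewrite divr_ge0 ?(ltW (V0_gt0 i))// mulr_ge0// bump_ge0.
  - rewrite divr_ge0 ?(ltW delta_gt0)// mulr_ge0//.
    exact: le_trans (bump_leB 0).
  - apply: ler_pM; rewrite ?invr_ge0 ?(ltW (V0_gt0 i))//.
    + by rewrite mulr_ge0// bump_ge0.
    + rewrite ler_wpM2l//; apply: le_trans (bump_leB _); exact: ler_norm.
    + by rewrite lef_pV2// ?posrE//; exact: V_ge.
pose s (y : n.-tuple R) : n.-tuple R :=
  [tuple (Num.sqrt (V1 i) * tnth y i)%R | i < n].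
have ms : measurable_fun setT s.
  apply/measurable_fun_tnthP => i.
  rewrite (_ : _ \o _ = fun y => (Num.sqrt (V1 i) * tnth y i)%R).
    by apply: measurable_funM => //; exact: measurable_tnth.
  by apply/funext => y /=; rewrite tnth_mktuple.
pose c := (A ^+ 2 * (3 / 16) ^+ N ^+ 2 / (4 * M%:R))%R.
have c0 : (0 <= c)%R.
  by rewrite divr_ge0// ?mulr_ge0// sqr_ge0.
have sE1 w : s [tuple X i w | i < n] = noisy_data (V (flip j theta)) w.
  by apply: eq_from_tnth => i; rewrite !tnth_mktuple.
have sE0 w : s [tuple (X i w / Num.sqrt (r i))%R | i < n] =
    noisy_data (V theta) w.
  apply: eq_from_tnth => i; rewrite !tnth_mktuple /r.
  rewrite sqrtrM ?(ltW (V1_gt0 i))// sqrtrV ?(ltW (V0_gt0 i))//.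
  by field; rewrite !gt_eqF ?sqrtr_gt0.
have -> : \int[P]_w cell_loss N Vt delta A j false (noisy_data (V theta) w) =
    \int[P]_w (cell_loss N Vt delta A j false \o s)
      [tuple (X i w / Num.sqrt (r i))%R | i < n].
  by apply: eq_integral => w _ /=; rewrite sE0.
have -> : \int[P]_w cell_loss N Vt delta A j true
      (noisy_data (V (flip j theta)) w) =
    \int[P]_w (cell_loss N Vt delta A j true \o s) [tuple X i w | i < n].
  by apply: eq_integral => w _ /=; rewrite sE1.
apply: (gaussian_two_point X_indep X_normal r1 rs c0).
- by apply: measurableT_comp => //; exact: measurable_cell_loss.
- by move=> y; exact: cell_loss_ge0.
- by apply: measurableT_comp => //; exact: measurable_cell_loss.
- by move=> y; exact: cell_loss_ge0.
- by move=> y; exact: cell_separation.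
Qed.

Lemma cell_two_point j theta : ((A * B / delta) ^+ 2 * cell_count j <= 1)%R ->
  (A ^+ 2 * (3 / 16) ^+ N ^+ 2 / (4 * M%:R) / 2)%:E <=
  \int[P]_w cell_loss N Vt delta A j (theta j) (noisy_data (V theta) w) +
  \int[P]_w cell_loss N Vt delta A j (flip j theta j)
              (noisy_data (V (flip j theta)) w).
Proof.
move=> cnt; have fj : flip j theta j = ~~ theta j by rewrite ffunE eqxx.
case tj : (theta j) in fj *; rewrite fj /=; last exact: cell_two_point_false.
rewrite addeC; have := @cell_two_point_false j (flip j theta) fj cnt.
by rewrite flipK.
Qed.

End cell_two_point.

(** * The minimax lower bound *)

Section minimax_lower_bound.
Context d (T : measurableType d) (R : realType) (P : probability T R).
Variables (x : nat -> nat -> R) (eps : forall n : nat, 'I_n -> {RV P >-> R}).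
Hypothesis eps_indep : forall n : nat, mutually_independent (@eps n).
Hypothesis eps_normal : forall (n : nat) (i : 'I_n), standard_normal (@eps n i).

(** In a cell with more than 2n/M design points the bit may be easy to detect,
    and only the trivial bound 0 is available.  The lower bound e_j below is
    linear in the number of design points and negative on these crowded cells;
    as the cells hold at most n points in all, the e_j still sum to half of what
    M empty cells would give. *)
Lemma minimax_risk_ge_bumps (n N M : nat) (delta A B : R)
    (Vclass gclass : set (R -> R)) :
  (0 < n)%N -> (2 <= N)%N -> (0 < M)%N -> 0 < delta -> 0 <= A ->
  (forall t, `|bump_deriv N 0 t| <= B) ->
  (A * B / delta) ^+ 2 * (2 * n%:R) <= M%:R ->
  gclass (fun=> 0) ->
  (forall theta : {ffun 'I_M -> bool},
    Vclass (bump_variance N delta A theta)) ->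
  ((A ^+ 2 * (3 / 16) ^+ N ^+ 2 / 32)%:E <=
    minimax_risk x (@eps) n Vclass gclass)%E.
Proof.
move=> n0 N2 M0 delta0 A0 HB hcnt g0 hV.
apply: le_ereal_inf_tmp => _ [Vt hVt <-].
set S := ereal_sup _.
pose p (i : 'I_n) := x n i.+1.
pose V (theta : {ffun 'I_M -> bool}) := bump_variance N delta A theta.
pose c := A ^+ 2 * (3 / 16) ^+ N ^+ 2 / (4 * M%:R).
pose cnt j := cell_count (M := M) p j.
pose e j := c / 2 * (1 - M%:R * cnt j / (2 * n%:R)).
have n_gt0 : 0 < n%:R :> R by rewrite ltr0n.
have M_gt0 : 0 < M%:R :> R by rewrite ltr0n.
have c0 : 0 <= c by rewrite divr_ge0// ?mulr_ge0// sqr_ge0.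
have c2_ge0 : 0 <= c / 2 by rewrite divr_ge0.
have sum_e : A ^+ 2 * (3 / 16) ^+ N ^+ 2 / 32 <= (\sum_j e j) / 2.
  rewrite /e -mulr_sumr sumrB sumr_const card_ord.
  have -> : \sum_(j < M) M%:R * cnt j / (2 * n%:R) =
      M%:R * (\sum_j cnt j) / (2 * n%:R).
    by rewrite mulr_sumr mulr_suml.
  have h : \sum_j cnt j <= n%:R by exact: sum_cell_count.
  have h2 : M%:R * (\sum_j cnt j) / (2 * n%:R) <= M%:R / 2.
    rewrite ler_pdivrMr ?mulr_gt0//.
    have -> : M%:R / 2 * (2 * n%:R) = M%:R * n%:R :> R by field.
    by rewrite ler_wpM2l.
  have -> : A ^+ 2 * (3 / 16) ^+ N ^+ 2 / 32 = c / 2 * (M%:R / 2) / 2.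
    by rewrite /c; field; rewrite gt_eqF.
  by rewrite ler_pM2r// ler_wpM2l//; lra.
apply: (@le_trans _ _ ((\sum_j e j) / 2)%:E); first by rewrite lee_fin.
have obsE theta w : @observations d T R P x (@eps) (fun=> 0) (V theta) n w =
    noisy_data (@eps n) p (V theta) w.
  by apply: eq_from_tnth => i; rewrite !tnth_mktuple add0r.
have mG (j : 'I_M) b theta : measurable_fun setT (fun w =>
    cell_loss N Vt delta A j b (noisy_data (@eps n) p (V theta) w)).
  apply: measurableT_comp; first exact: measurable_cell_loss.
  exact: measurable_noisy_data.
apply: (assouad (G := fun j theta => (\int[P]_w
    cell_loss N Vt delta A j (theta j) (noisy_data (@eps n) p (V theta) w))%E)
  (risk := fun theta => global_risk x (@eps) (fun=> 0) (V theta) Vt)).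
- by move=> j theta; apply: integral_ge0 => w _; exact: cell_loss_ge0.
- move=> theta; rewrite -ge0_integral_sum//; last first.
    by move=> j w _; exact: cell_loss_ge0.
  rewrite /global_risk; apply: ge0_le_integral => //.
  + by move=> w _; apply: sume_ge0 => j _; exact: cell_loss_ge0.
  + by apply: emeasurable_sum => j; exact: mG.
  + have m1 : measurable_fun setT (cst 1 : R -> R) by [].
    have mL := measurable_weighted_loss hVt (fun=> ler01) m1
      (measurable_bump_variance N2 delta A theta).
    rewrite (_ : (fun w => _) = weighted_loss Vt (cst 1) (V theta) \o
        noisy_data (@eps n) p (V theta)).
      by apply: (measurableT_comp mL); exact: measurable_noisy_data.
    apply/funext => w /=; apply: eq_integral => t _.
    by rewrite obsE mul1r.
  + by move=> w _; rewrite obsE; exact: sum_cell_loss_le.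
- move=> j theta; have [le|lt] := leP (M%:R * cnt j) (2 * n%:R).
    apply: (@le_trans _ _ (c / 2)%:E).
      rewrite lee_fin /e ler_piMr// lerBlDr lerDl divr_ge0//.
      by rewrite mulr_ge0// sumr_ge0.
    apply: (cell_two_point (@eps_indep n) (@eps_normal n) _ N2 M0 delta0 A0 HB)
      => //.
    rewrite -(ler_pM2l M_gt0) mulr1; apply: le_trans hcnt.
    by rewrite mulrCA ler_wpM2l// sqr_ge0.
  apply: (@le_trans _ _ 0%E); last first.
    by apply: adde_ge0; apply: integral_ge0 => w _; exact: cell_loss_ge0.
  rewrite lee_fin /e mulr_ge0_le0// subr_le0.
  by rewrite ler_pdivlMr ?mul1r ?mulr_gt0// ltW.
- move=> theta; apply: ereal_sup_ubound.
  by exists ((fun=> 0), V theta) => //; split => //; exact: hV.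
Qed.

End minimax_lower_bound.

(** M is n^(1 / (2 gamma + 1)) rounded up: large enough for the overlap
    condition n <= M^(2 gamma + 1), and at most twice that power, which costs
    the factor 2^(-2 gamma) in the rate. *)
Lemma cell_number (R : realType) (gamma : R) (n : nat) :
  0 < gamma -> (0 < n)%N ->
  exists2 M : nat, (0 < M)%N &
    n%:R <= M%:R `^ (2 * gamma + 1) /\
    2 `^ (- (2 * gamma)) * n%:R `^ (- (2 * gamma / (2 * gamma + 1))) <=
      M%:R `^ (- (2 * gamma)).
Proof.
move=> g0 n0; set k := 2 * gamma + 1; have k0 : 0 < k by rewrite /k; lra.
have n1 : 1 <= n%:R :> R by rewrite ler1n.
pose a : R := n%:R `^ k^-1.
have a1 : 1 <= a by rewrite /a -[leLHS](powRr0 n%:R) ler_powR// invr_ge0 ltW.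
have a0 : 0 < a by apply: lt_le_trans a1.
have ceil0 : 0 < Num.ceil a by rewrite ceil_gt0.
have ME : (`|Num.ceil a|%N)%:R = (Num.ceil a)%:~R :> R.
  by rewrite natr_absz gtr0_norm.
have aM : a <= (`|Num.ceil a|%N)%:R by rewrite ME ceil_ge.
have Ma : (`|Num.ceil a|%N)%:R <= 2 * a.
  have := ceilB1_lt a; rewrite ME intrB; lra.
exists `|Num.ceil a|%N; first by rewrite absz_gt0 gt_eqF.
move: (`|Num.ceil a|%N) aM Ma => M aM Ma {ceil0 ME}.
have M0 : 0 < M%:R :> R by apply: lt_le_trans aM.
split.
  have -> : n%:R = a `^ k by rewrite /a -powRrM mulVf ?gt_eqF// powRr1.
  by apply: ge0_ler_powR => //; rewrite ?nnegrE ltW.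
have -> : n%:R `^ (- (2 * gamma / k)) = a `^ (- (2 * gamma)).
  by rewrite /a -powRrM; congr (_ `^ _); field; rewrite gt_eqF.
rewrite -powRM// ?(ltW a0)// !powRN lef_pV2 ?posrE ?powR_gt0//; last first.
  by rewrite mulr_gt0.
by apply: ge0_ler_powR => //;
  rewrite ?nnegrE ?mulr_ge0 ?(ltW a0) ?(ltW g0) ?(ltW M0).
Qed.

Theorem theorem4p1 (R : realType) (C1 C2 beta gamma delta : R)
  (C1_gt0 : 0 < C1) (C2_gt0 : 0 < C2) (beta_gt0 : 0 < beta)
  (gamma_gt0 : 0 < gamma) (delta_gt0 : 0 < delta)
  (delta_lt : 1 < gamma -> delta < C2)
  (x : nat -> nat -> R) (design_x : regular_design x)
  (d : measure_display) (T : measurableType d) (P : probability T R)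
  (eps : forall n : nat, 'I_n -> {RV P >-> R})
  (eps_indep : forall n : nat, mutually_independent (eps n))
  (eps_normal : forall (n : nat) (i : 'I_n), standard_normal (eps n i)) :
  exists K : R, 0 < K /\
    forall n : nat, (0 < n)%N ->
      ((K * n%:R `^ (- (2 * gamma / (2 * gamma + 1))))%:E <=
       minimax_risk x eps n (holder_class_pos C1 C2 gamma delta)
                            (holder_class C1 C2 beta))%E.
Proof.
set m := strict_floor gamma.
have [B B0 HB] := bump_deriv_bounded R m.+2.
have [c c0 [c1 c2 c3 c4]] : exists2 c : R, 0 < c & [/\ c * (4 * B) <= C1,
    c * B <= C2, c * B <= delta / 2 & 1 < gamma -> delta + c * B <= C2].
  (* The third bound, delta / 2, is for the overlap of the laws. *)
  pose b := Num.min (Num.min (C1 / 4) C2)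
    (Num.min (delta / 2) (if 1 < gamma then C2 - delta else 1)).
  have b0 : 0 < b.
    rewrite !lt_min C2_gt0 !divr_gt0//=.
    by case: ifP => // g1; rewrite subr_gt0 delta_lt.
  have bb : b <= b by [].
  rewrite {2}/b !le_min in bb; have /andP[/andP[b1 b2] /andP[b3 b4]] := bb.
  exists (b / B); first by rewrite divr_gt0.
  rewrite mulrCA (divfK (lt0r_neq0 B0)); split=> //.
  - by rewrite -ler_pdivlMl// mulrC.
  - by move=> g1; move: b4; rewrite g1; lra.
pose q : R := (3 / 16) ^+ m.+2.
have q0 : 0 < q by rewrite exprn_gt0// divr_gt0.
exists (c ^+ 2 * q ^+ 2 / 32 * 2 `^ (- (2 * gamma))); split.
  by rewrite mulr_gt0 ?powR_gt0// divr_gt0// mulr_gt0// exprn_gt0.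
move=> n n0.
have [M M0 [nM Mn]] := cell_number gamma_gt0 n0.
have M1 : 1 <= M%:R :> R by rewrite ler1n.
have M_gt0 : 0 < M%:R :> R by rewrite ltr0n.
pose A := c * M%:R `^ (- gamma).
have A0 : 0 <= A by rewrite mulr_ge0 ?powR_ge0// ltW.
have Ag : A * M%:R `^ gamma = c.
  by rewrite /A -mulrA powRN mulVf ?mulr1// gt_eqF// powR_gt0.
have Ac : A <= c.
  rewrite /A ger_pMr// powRN invf_le1 ?powR_gt0//.
  by rewrite -[leLHS](powRr0 M%:R) ler_powR// ltW.
have A2 : A ^+ 2 = c ^+ 2 * M%:R `^ (- (2 * gamma)).
  rewrite exprMn; congr (_ * _).
  by rewrite -powR_mulrn ?powR_ge0// -powRrM; congr (_ `^ _); ring.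
apply: (le_trans _ (minimax_risk_ge_bumps x eps_indep eps_normal
  (N := m.+2) (A := A) (B := B) (delta := delta) n0 _ M0 _ _ _ _ _ _)) => //.
- rewrite lee_fin A2 -/q.
  have -> : c ^+ 2 * M%:R `^ (- (2 * gamma)) * q ^+ 2 / 32 =
    c ^+ 2 * q ^+ 2 / 32 * M%:R `^ (- (2 * gamma)) by ring.
  by rewrite -mulrA ler_wpM2l// divr_ge0// mulr_ge0// sqr_ge0.
- by move=> t; exact: HB.
- have E : (A * B / delta) ^+ 2 =
      (c * B / delta) ^+ 2 * M%:R `^ (- (2 * gamma)).
    have -> : (A * B / delta) ^+ 2 = A ^+ 2 * (B / delta) ^+ 2.
      by rewrite -mulrA exprMn.
    by rewrite A2; ring.
  have h : (c * B / delta) ^+ 2 <= 4^-1.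
    have -> : 4^-1 = (2^-1) ^+ 2 :> R by field.
    rewrite lerXn2r ?nnegrE ?divr_ge0 ?mulr_ge0
      ?(ltW B0) ?(ltW c0) ?(ltW delta_gt0)//.
    by rewrite ler_pdivrMr//; lra.
  have h2 : M%:R `^ (- (2 * gamma)) * n%:R <= M%:R.
    rewrite powRN mulrC ler_pdivrMr ?powR_gt0//; apply: le_trans nM _.
    by rewrite powRD ?powRr1 1?mulrC//; apply/implyP => _; rewrite gt_eqF.
  rewrite E -mulrA (mulrCA _ 2); apply: le_trans (_ : 4^-1 * (2 * M%:R) <= _).
    by rewrite ler_pM ?sqr_ge0 ?mulr_ge0 ?powR_ge0// ler_wpM2l.
  by lra.
- exact: holder_class0.
- move=> theta; apply: (bump_variance_holder (B := B)) => //.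
  + exact: ltW.
  + by rewrite Ag.
  + by rewrite Ag.
  + move=> m0; have g1 : 1 < gamma by rewrite (strict_floorP 1 gamma_gt0).
    apply: le_trans (c4 g1); rewrite lerD2l ler_wpM2r// ltW//.
Qed.
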